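(* Let $G$ be a connected graph with $m\ge 1$ edges. Then, for every real $t\ge 2$, $$\Psi_t(G)\ge \Psi_t(P_{m+1}).$$
   Context: All graphs are finite, simple, undirected and unweighted. For real $x$, $x_+=\max\{x,0\}$. For a graph $G$, $Q(G)=D(G)+A(G)$ is the signless Laplacian matrix, where $A(G)$ is the adjacency matrix and $D(G)$ the diagonal matrix of vertex degrees; $\lambda_i(Q(G))$ are its eigenvalues, repeated with multiplicity. For $t\ge 2$, $\Psi_t(G):=\sum_i\bigl(\lambda_i(Q(G))-t\bigr)_+^2$, the sum being over all eigenvalues of $Q(G)$. $P_k$ denotes the path on $k$ vertices. *)

(* Defs.v *)
From HB Require Import structures.
From mathcomp Require Import all_boot all_order all_algebra.
From mathcomp Require Import polyrcf complex.
Set Implicit Arguments.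
Unset Strict Implicit.
Unset Printing Implicit Defensive.
Import Order.TTheory GRing.Theory Num.Theory.
Local Open Scope ring_scope.

Record sgraph := SGraph {
  vertex :> finType;
  adj : rel vertex;
  adj_sym : symmetric adj;
  adj_irr : irreflexive adj }.

Definition edges (G : sgraph) : {set {set G}} :=
  [set [set p.1; p.2] | p in [set p : G * G | adj p.1 p.2]].

(* Exactly one component; in particular the graph without vertices is not
   connected. *)
Definition connected_graph (G : sgraph) : Prop := n_comp (@adj G) G = 1%N.

Definition degree (G : sgraph) (x : G) : nat := #|[set y | adj x y]|.

Definition path_adj (k : nat) : rel 'I_k :=
  fun i j => (i.+1 == j :> nat) || (j.+1 == i :> nat).

Lemma path_adj_sym k : symmetric (@path_adj k).
Proof. by move=> i j; rewrite /path_adj orbC. Qed.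

Lemma path_adj_irr k : irreflexive (@path_adj k).
Proof. by move=> i; rewrite /path_adj orbb -[X in _ == X]add0n -add1n eqn_add2r. Qed.

Definition path_graph (k : nat) : sgraph :=
  SGraph (@path_adj_sym k) (@path_adj_irr k).

Section Spectrum.
Variable R : rcfType.

(* Rows and columns are indexed by 'I_#|G| through the enumeration of the
   vertices. *)
Definition adj_mx (G : sgraph) : 'M[R]_#|G| :=
  \matrix_(i, j) (adj (enum_val i : G) (enum_val j))%:R.

Definition deg_mx (G : sgraph) : 'M[R]_#|G| :=
  diag_mx (\row_i (degree (enum_val i : G))%:R).

Definition signless_laplacian (G : sgraph) : 'M[R]_#|G| :=
  deg_mx G + adj_mx G.

(* The real eigenvalues, each repeated according to its multiplicity as a root
   of the characteristic polynomial. For a symmetric matrix these are all the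
   eigenvalues, see [symmetric_eigenvalues]. *)
Definition eigenvalues n (A : 'M[R]_n) : seq R :=
  flatten [seq nseq (mup x (char_poly A)) x | x <- rootsR (char_poly A)].

Definition Psi (t : R) (G : sgraph) : R :=
  \sum_(x <- eigenvalues (signless_laplacian G)) Num.max (x - t) 0 ^+ 2.

Lemma signless_laplacian_sym G :
  (signless_laplacian G)^T = signless_laplacian G.
Proof.
rewrite /signless_laplacian linearD /= /deg_mx tr_diag_mx; congr (_ + _).
by apply/matrixP => i j; rewrite !mxE adj_sym.
Qed.

Lemma mup_prod_XsubC (s : seq R) x :
  mup x (\prod_(y <- s) ('X - y%:P)) = count_mem x s.
Proof.
elim: s => [|y s IHs]; first by rewrite big_nil mupNroot ?root1.
rewrite big_cons mupM ?polyXsubC_eq0 ?monic_neq0 ?monic_prod_XsubC //.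
by rewrite IHs /= -['X - _]expr1 mup_XsubCX; case: eqVneq.
Qed.

Lemma symmetric_eigenvalue_real n (A : 'M[R]_n) (z : R[i]) : A^T = A ->
  root (map_poly (real_complex R) (char_poly A)) z -> z = (complex.Re z)%:C%C.
Proof.
move=> symA; rewrite map_char_poly -eigenvalue_root_char.
move=> /eigenvalueP[v vA v_neq0].
set B := map_mx _ A in vA.
have BE : map_mx Num.conj B^T = B.
  apply/matrixP => i j; rewrite !mxE -{2}symA mxE.
  by rewrite conj_Creal //; apply/complex_realP; exists (A j i).
pose w := map_mx Num.conj v^T.
have Bw : B *m w = z^* *: w.
  by rewrite -BE /w -map_mxM -trmx_mul vA linearZ /= map_mxZ.
have : v *m B *m w = v *m (B *m w) by rewrite mulmxA.
rewrite vA Bw -scalemxAl -scalemxAr => /matrixP/(_ 0 0); rewrite !mxE => E.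
have /mulIf/(_ _ _ E) zE : \sum_j v 0 j * w j 0 != 0.
  apply: contraNneq v_neq0 => s0; apply/eqP/rowP => j; rewrite mxE.
  have vw k : v 0 k * w k 0 = `|v 0 k| ^+ 2 by rewrite !mxE normCK.
  have := psumr_eq0P _ s0 (i := j) isT; rewrite vw => H.
  apply/eqP; rewrite -normr_eq0 -sqrf_eq0; apply/eqP/H => k _.
  by rewrite vw exprn_ge0.
by have /CrealP/complex_realP[x ->] := esym zE.
Qed.

Lemma symmetric_eigenvalues n (A : 'M[R]_n) : A^T = A ->
  char_poly A = \prod_(x <- eigenvalues A) ('X - x%:P).
Proof.
move=> symA; have [r] :=
  closed_field_poly_normal (map_poly (real_complex R) (char_poly A)).
have /monicP -> : map_poly (real_complex R) (char_poly A) \is monic.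
  by rewrite map_char_poly char_poly_monic.
rewrite scale1r => Er.
pose s := [seq complex.Re z | z <- r].
have Es : char_poly A = \prod_(x <- s) ('X - x%:P).
  apply: (map_poly_inj (real_complex R)); rewrite Er rmorph_prod big_map.
  apply: eq_big_seq => z zr; rewrite /= map_polyXsubC /=.
  rewrite -(@symmetric_eigenvalue_real _ A z) //.
  by rewrite Er root_prod_XsubC.
rewrite {1}Es; apply: perm_big; apply/allP => /= x _; apply/eqP.
have p_neq0 : char_poly A != 0 by rewrite monic_neq0 ?char_poly_monic.
rewrite -mup_prod_XsubC -Es /eigenvalues count_flatten -map_comp.
have xroots : (x \in rootsR (char_poly A)) = root (char_poly A) x.
  by have /(_ x) := roots_on_rootsR p_neq0; rewrite in_itv.
have uroots : uniq (rootsR (char_poly A)) by apply: uniq_roots.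
rewrite sumnE big_map.
under eq_bigr do rewrite /= count_nseq /=.
have [rx|nrx] := boolP (root (char_poly A) x); last first.
  rewrite mupNroot // big1_seq // => y /andP[_ yr].
  by case: eqVneq => // yx; rewrite yx xroots (negPf nrx) in yr.
rewrite (bigD1_seq x) ?xroots //= eqxx mul1n big1 ?addn0 // => y yx.
by rewrite (negPf yx).
Qed.

End Spectrum.

(* Main.v *)
Require Import Defs.
From mathcomp Require Import all_boot all_order all_algebra.
From mathcomp Require Import reals topology normedtype derive trigo.
From mathcomp Require Import zify ring lra.

(** Put s = t - 2. For a set S of edges let [gram S] be the Gram matrix of the
    0/1 incidence vectors of the edges in S: 2 on the diagonal, 1 for two edges
    with a common end. If B is the vertex-edge incidence matrix, Q(G) = B B^T
    and the Gram matrix of all edges is B^T B, so the spectral sum Psi_t(G) is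
    at least the corresponding sum [psi t] of the Gram matrix
    ([psi_gram_le]). On the other side Q(P_n) has the eigenvalues
    2 - 2 cos (k pi / n), which makes Psi_t(P_{m+1}) equal to
    [path_sum s m.+1], the sum of (2 cos (k pi / (m+1)) - s)_+^2 over
    0 < k <= m. This vanishes for t >= 4. For 2 <= t <= 4 the theorem becomes
    [line_psi_ge]: a nonempty connected set S of edges satisfies
    path_sum s (#|S| + 1) <= psi t (gram S). It is proved by induction on #|S|.

    Lower bounds for [psi] come from a variational principle: every positive
    semidefinite Y gives 2 tr ((A - t) Y) - tr (Y Y) <= psi t A
    ([psi_ge_trial]).

    Suppose that some vertex lies on three edges of S, forming a claw C. The
    rest of S splits into connected pieces. As trial matrix take the optimal
    ones of the pieces plus a rank-one matrix along a vector that is 1 on C and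
    slightly positive on the edges by which the pieces are attached to C. The
    price for entering a piece is controlled because the incident edges of a
    vertex force A >= c c^T ([negative_part_le]). The result [psi_claw] is
    that psi t (gram S) exceeds the sum over the pieces by at least
    (lam - s)^2, where lam lies between 2 and 2.8 and depends on how the pieces are
    attached. By induction the pieces can be replaced by paths, and it
    remains to bound the loss path_sum s (4 + sum m_i) - sum path_sum s (m_i + 1)
    by (lam - s)^2. The fractions j/a and j/b interlace with the fractions
    k/(a+b), so the sums over 0 < k < n of a nonnegative decreasing
    function of k/n are superadditive in n, and subadditive up to one term
    ([fsumD_le], [fsumD_ge]). The latter directly bounds the loss by multiples of (2 - s)^2, which is enough
    for s near 2. The former, applied to the difference between a majorant
    al u^2 + be u^4 and (u - s)_+^2, whose power sums are explicit, settles
    the smaller s ([path_sum_poly]).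

    If no vertex lies on three edges, S is a path or a cycle. Sine waves
    diagonalise the Gram matrix of a path and give the value [path_sum]
    exactly. For a cycle on m edges constant, cosine and sine waves give the
    eigenvalues 2 + 2 cos (2 i pi / m), and [path_sum_le_cycle] compares the
    sums by pairing the terms 2 i - 1 and 2 i of the path with two neighbouring
    terms of the cycle. *)

Set Implicit Arguments.
Unset Strict Implicit.
Unset Printing Implicit Defensive.
Import Order.TTheory GRing.Theory Num.Theory.
Local Open Scope ring_scope.

(** * The spectral theorem for real symmetric matrices *)

Section Spectral.
Variable R : rcfType.

Lemma mulmx_tr_ge0 n (u : 'rV[R]_n) : 0 <= (u *m u^T) 0 0.
Proof. by rewrite mxE sumr_ge0 // => i _; rewrite mxE -expr2 sqr_ge0. Qed.

Lemma mulmx_tr_eq0 n (u : 'rV[R]_n) : ((u *m u^T) 0 0 == 0) = (u == 0).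
Proof.
apply/eqP/eqP => [|->]; last by rewrite mul0mx mxE.
rewrite mxE => u0; apply/rowP => i; rewrite mxE; apply/eqP.
have nneg j : true -> 0 <= u 0 j * u^T j 0 by rewrite mxE -expr2 sqr_ge0.
by have := psumr_eq0P nneg u0 isT (i := i); rewrite mxE -expr2 => /eqP; rewrite sqrf_eq0.
Qed.

(** The Householder reflection in the hyperplane orthogonal to e - v, where e is
    the first basis vector. *)
Lemma reflection_exists n (v : 'rV[R]_n.+1) : (v *m v^T) 0 0 = 1 ->
  exists H : 'M[R]_n.+1, [/\ H^T = H, H *m H = 1%:M & delta_mx 0 0 *m H = v].
Proof.
move=> v1; pose e : 'rV[R]_n.+1 := delta_mx 0 0.
have [->|ev] := eqVneq v e.
  by exists 1%:M; rewrite trmx1 !mulmx1; split.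
pose u := e - v; pose k := (u *m u^T) 0 0.
have u_neq0 : u != 0 by rewrite subr_eq0 eq_sym.
have k_neq0 : k != 0 by rewrite mulmx_tr_eq0.
have uuE : u *m u^T = k%:M by rewrite [LHS]mx11_scalar.
exists (1%:M - (2 / k) *: (u^T *m u)); split.
- by rewrite linearB /= trmx1 linearZ /= trmx_mul trmxK.
- pose K := u^T *m u; have KK : K *m K = k *: K.
    by rewrite /K -mulmxA (mulmxA u) uuE mul_scalar_mx -scalemxAr.
  rewrite -/K mulmxBr mulmx1 mulmxBl mul1mx -scalemxAl -scalemxAr KK.
  apply/matrixP => i j; rewrite !mxE; field.
  by rewrite k_neq0.
rewrite mulmxBr mulmx1 -scalemxAr mulmxA.
have ee : e *m e^T = 1%:M.
  rewrite [LHS]mx11_scalar; congr (_%:M).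
  by rewrite trmx_delta mul_delta_mx mxE !eqxx.
have vv : v *m v^T = 1%:M by rewrite [LHS]mx11_scalar v1.
have ve : v *m e^T = e *m v^T.
  rewrite [LHS]mx11_scalar [RHS]mx11_scalar; congr (_%:M).
  by rewrite !mxE; apply: eq_bigr => j _; rewrite !mxE mulrC.
pose c := (e *m v^T) 0 0.
have evE : e *m v^T = c%:M by rewrite [LHS]mx11_scalar.
have kE : k = 2 * (1 - c).
  have : k%:M = (2 * (1 - c))%:M :> 'M[R]_1.
    rewrite -uuE /u linearB /= mulmxBl !mulmxBr ee vv ve evE.
    by apply/matrixP => i j; rewrite !mxE !ord1 /= !mulr1n; ring.
  by move=> /matrixP /(_ 0 0); rewrite !mxE /= !mulr1n.
have -> : e *m u^T = (k / 2)%:M.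
  rewrite /u linearB /= mulmxBr ee evE; apply/matrixP => i j.
  by rewrite !mxE !ord1 /= !mulr1n kE; field.
rewrite mul_scalar_mx scalerA.
have -> : 2 / k * (k / 2) = 1 by field.
by rewrite scale1r /u opprB addrC subrK.
Qed.

Lemma symmetric_has_eigenvector n (A : 'M[R]_n.+1) : A^T = A ->
  exists a (v : 'rV[R]_n.+1), v *m A = a *: v /\ (v *m v^T) 0 0 = 1.
Proof.
move=> symA; have charA := symmetric_eigenvalues symA.
have : size (char_poly A) = n.+2 by rewrite size_char_poly.
rewrite charA size_prod_XsubC => -[]; case: (eigenvalues A) charA => // a s charA _.
have : eigenvalue A a by rewrite eigenvalue_root_char charA root_prod_XsubC mem_head.
move=> /eigenvalueP [v vA v_neq0]; pose k := (v *m v^T) 0 0.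
have k_gt0 : 0 < k by rewrite lt_def mulmx_tr_eq0 v_neq0 mulmx_tr_ge0.
have sk0 : Num.sqrt k != 0 by rewrite gt_eqF ?sqrtr_gt0.
exists a, ((Num.sqrt k)^-1 *: v); split.
  by rewrite -scalemxAl vA !scalerA mulrC.
have -> : ((Num.sqrt k)^-1 *: v *m ((Num.sqrt k)^-1 *: v)^T) 0 0
    = (Num.sqrt k)^-1 * ((Num.sqrt k)^-1 * k).
  by rewrite linearZ /= -scalemxAl -scalemxAr mxE mxE.
rewrite -[X in _ * (_ * X)](sqr_sqrtr (ltW k_gt0)).
by field.
Qed.

(** The spectral theorem, by deflation: the Householder reflection exchanging
    a unit eigenvector and the first basis vector turns the matrix into a
    block-diagonal one. *)
Lemma symmetric_diagonalization n (A : 'M[R]_n) : A^T = A ->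
  exists (P : 'M[R]_n) (d : 'rV[R]_n),
    P *m P^T = 1%:M /\ A = P^T *m diag_mx d *m P.
Proof.
elim: n A => [|n IHn] A symA.
  exists 1%:M, 0; split; first by rewrite trmx1 mulmx1.
  by apply/matrixP => -[].
have [a [v [vA v1]]] := symmetric_has_eigenvector symA.
have [H [symH HH eH]] := reflection_exists v1.
pose B : 'M[R]_(1 + n) := H *m A *m H.
have symB : B^T = B by rewrite /B !trmx_mul symH symA mulmxA.
have AB : A = H *m B *m H by rewrite /B !mulmxA HH mul1mx -mulmxA HH mulmx1.
have eB : delta_mx 0 0 *m B = a *: (delta_mx 0 0 : 'rV_n.+1).
  by rewrite /B !mulmxA eH vA -scalemxAl -eH -mulmxA HH mulmx1.
have eB' j : B 0 j = a * (0 == j)%:R.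
  have /matrixP /(_ 0 j) := eB; rewrite -rowE !mxE => ->.
  by rewrite eqxx /= eq_sym.
clearbody B.
have [P' [d' [PP' BE]]] : exists (P : 'M[R]_n) d,
    P *m P^T = 1%:M /\ drsubmx B = P^T *m diag_mx d *m P.
  by apply: IHn; rewrite trmx_drsub symB.
have BB : B = block_mx a%:M 0 0 (drsubmx B).
  rewrite -[LHS]submxK; congr block_mx.
  - by rewrite [LHS]mx11_scalar !mxE lshift0 eB' eqxx mulr1.
  - apply/matrixP => i j; rewrite !mxE ord1 lshift0 eB'.
    by rewrite -val_eqE /= mulr0.
  apply/matrixP => i j; rewrite !mxE ord1 lshift0.
  by rewrite -symB mxE eB' -val_eqE /= mulr0.
pose K : 'M[R]_(1 + n) := block_mx 1%:M 0 0 P'.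
pose d : 'rV[R]_(1 + n) := row_mx a%:M d'.
have KK : K *m K^T = 1%:M.
  rewrite /K tr_block_mx !trmx0 trmx1 mulmx_block.
  by rewrite !(mul0mx, mulmx0, addr0, add0r) mul1mx PP' -scalar_mx_block.
have KD : B = K^T *m diag_mx d *m K.
  rewrite BB BE /K tr_block_mx !trmx0 trmx1 /d.
  have -> : diag_mx (row_mx a%:M d') = block_mx (a%:M : 'M_1) 0 0 (diag_mx d').
    rewrite diag_mx_row; congr block_mx; apply/matrixP => i j.
    by rewrite !mxE !ord1.
  by rewrite !mulmx_block !(mul0mx, mulmx0, addr0, add0r, mulmx1, mul1mx).
exists (K *m H : 'M_n.+1), d; split.
  by rewrite trmx_mul symH mulmxA -(mulmxA K) HH mulmx1.
by rewrite AB KD trmx_mul symH !mulmxA.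
Qed.

End Spectral.

(** * A variational principle for sums over eigenvalues above a level *)

Section PositivePart.
Variable R : rcfType.

Definition pos2 (x : R) : R := Num.max x 0 ^+ 2.

Lemma pos2_ge0 (x : R) : 0 <= pos2 x. Proof. exact: sqr_ge0. Qed.

Lemma pos2_mono (x y : R) : x <= y -> pos2 x <= pos2 y.
Proof.
move=> xy; have h : Num.max x 0 <= Num.max y 0.
  by rewrite ge_max !le_max xy lexx !orbT.
by rewrite /pos2 lerXn2r ?nnegrE // le_max lexx orbT.
Qed.

Lemma pos2E (x : R) : 0 <= x -> pos2 x = x ^+ 2.
Proof. by move=> x0; rewrite /pos2 max_l. Qed.

Lemma pos2_eq0 (x : R) : x <= 0 -> pos2 x = 0.
Proof. by move=> x0; rewrite /pos2 max_r // expr0n. Qed.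

Definition psi n (t : R) (A : 'M[R]_n) : R :=
  \sum_(x <- eigenvalues A) pos2 (x - t).

Definition qform n (A : 'M[R]_n) (v : 'cV[R]_n) : R := (v^T *m A *m v) 0 0.

Definition psdmx n (A : 'M[R]_n) := A^T = A /\ forall v, 0 <= qform A v.

(** Conjugation by an orthogonal matrix preserves the characteristic polynomial, so
    the diagonal entries are the eigenvalues with multiplicity. *)
Lemma char_poly_diagonalized n (P : 'M[R]_n) (d : 'rV[R]_n) :
  P *m P^T = 1%:M ->
  char_poly (P^T *m diag_mx d *m P) = \prod_(x <- [seq d 0 i | i : 'I_n]) ('X - x%:P).
Proof.
move=> PP; have PP' := mulmx1C PP.
rewrite /char_poly /char_poly_mx.
pose c (B : 'M[R]_n) := map_mx polyC B.
have -> : 'X%:M - c (P^T *m diag_mx d *m P) =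
    c P^T *m ('X%:M - c (diag_mx d)) *m c P.
  rewrite /c !map_mxM mulmxBr mulmxBl; congr (_ - _).
  by rewrite -mulmxA mul_scalar_mx -scalemxAr -map_mxM PP' map_mx1 scalemx1.
rewrite !det_mulmx mulrAC -det_mulmx -map_mxM PP' map_mx1 det1 mul1r.
rewrite big_map big_enum /= det_trig; last first.
  apply/is_trig_mxP => i j ij; rewrite !mxE.
  have -> : (i == j) = false by rewrite -val_eqE /= ltn_eqF.
  by rewrite !mulr0n polyC0 subr0.
by apply: eq_bigr => i _; rewrite !mxE eqxx !mulr1n.
Qed.

Lemma sum_eigenvalues n (P : 'M[R]_n) (d : 'rV[R]_n) (F : R -> R) :
  P *m P^T = 1%:M ->
  \sum_(x <- eigenvalues (P^T *m diag_mx d *m P)) F x = \sum_i F (d 0 i).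
Proof.
move=> PP; set A := P^T *m _ *m _.
have symA : A^T = A by rewrite /A !trmx_mul trmxK tr_diag_mx mulmxA.
have E := symmetric_eigenvalues symA.
rewrite (char_poly_diagonalized _ PP) in E.
have -> : \sum_i F (d 0 i) = \sum_(x <- [seq d 0 i | i : 'I_n]) F x.
  by rewrite big_map big_enum.
apply: perm_big; apply/allP => /= x _; apply/eqP.
by rewrite -!mup_prod_XsubC -E.
Qed.

(** The difference of the two sides is (x - y)^2 if x > 0, and -2 x y + y^2
    otherwise. *)
Lemma pos2_dual (x y : R) : 0 <= y -> 2 * (x * y) - y ^+ 2 <= pos2 x.
Proof.
move=> y0; rewrite /pos2 -subr_ge0; case: (lerP x 0) => x0.
  have := mulr_le0_ge0 x0 y0; have := sqr_ge0 y; lra.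
by have := sqr_ge0 (x - y); lra.
Qed.

Lemma qform_delta n (A : 'M[R]_n) i : qform A (delta_mx i 0) = A i i.
Proof. by rewrite /qform trmx_delta -rowE -colE !mxE. Qed.

Lemma qformD n (A B : 'M[R]_n) v : qform (A + B) v = qform A v + qform B v.
Proof. by rewrite /qform mulmxDr mulmxDl mxE. Qed.

Lemma qformN n (A : 'M[R]_n) v : qform (- A) v = - qform A v.
Proof. by rewrite /qform mulmxN mulNmx mxE. Qed.

Lemma qform_scalar n (a : R) (v : 'cV[R]_n) : qform a%:M v = a * qform 1%:M v.
Proof. by rewrite /qform !mul_mx_scalar scale1r -scalemxAl mxE. Qed.

Lemma qformM n (A B : 'M[R]_n) v : qform A (B *m v) = qform (B^T *m A *m B) v.
Proof. by rewrite /qform trmx_mul !mulmxA. Qed.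

Lemma qform1E n (v : 'cV[R]_n) : qform 1%:M v = \sum_i v i 0 ^+ 2.
Proof. by rewrite /qform mulmx1 mxE; apply: eq_bigr => i _; rewrite mxE expr2. Qed.

Lemma qform1_ge0 n (v : 'cV[R]_n) : 0 <= qform 1%:M v.
Proof. by rewrite qform1E sumr_ge0 // => i _; rewrite sqr_ge0. Qed.

Lemma qformE n (A : 'M[R]_n) v :
  qform A v = \sum_i \sum_j v i 0 * A i j * v j 0.
Proof.
rewrite /qform mxE exchange_big; apply: eq_bigr => j _.
rewrite mxE mulr_suml; apply: eq_bigr => i _.
by rewrite mxE.
Qed.

Lemma trmx_sqrE n (A : 'M[R]_n) : A^T = A -> \tr (A *m A) = \sum_i \sum_j A i j ^+ 2.
Proof.
move=> symA; apply: eq_bigr => i _; rewrite mxE; apply: eq_bigr => j _.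
by rewrite expr2 -{2}symA [X in _ * X]mxE.
Qed.

(** Since max(x,0)^2 is the supremum of 2xy - y^2 over y >= 0, the spectral
    functional dominates its matrix analogue at every positive semidefinite
    trial matrix: in an eigenbasis the off-diagonal entries of the trial matrix
    only contribute negatively. *)
Lemma psi_ge_trial n t (A Y : 'M[R]_n) : A^T = A -> psdmx Y ->
  2 * \tr ((A - t%:M) *m Y) - \tr (Y *m Y) <= psi t A.
Proof.
move=> symA [symY posY].
have [P [d [PP AE]]] := symmetric_diagonalization symA.
have PP' := mulmx1C PP.
pose Z := P *m Y *m P^T.
have symZ : Z^T = Z by rewrite /Z !trmx_mul trmxK symY mulmxA.
have posZ i : 0 <= Z i i.
  rewrite -qform_delta /Z -[P in P *m Y]trmxK -qformM; exact: posY.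
have YE : Y = P^T *m Z *m P.
  by rewrite /Z !mulmxA PP' mul1mx -mulmxA PP' mulmx1.
have trP (M : 'M[R]_n) : \tr (P^T *m M *m P) = \tr M.
  by rewrite -mulmxA mxtrace_mulC -mulmxA PP mulmx1.
have mulP (M N : 'M[R]_n) : P^T *m M *m P *m (P^T *m N *m P) = P^T *m (M *m N) *m P.
  by rewrite -[LHS]mulmxA (mulmxA P) (mulmxA P) PP mul1mx !mulmxA.
have -> : A - t%:M = P^T *m (diag_mx d - t%:M) *m P.
  by rewrite mulmxBr mulmxBl -AE -mulmxA mul_scalar_mx -scalemxAr PP' scalemx1.
clearbody Z; rewrite YE !mulP !trP.
have -> : \tr ((diag_mx d - t%:M) *m Z) = \sum_i (d 0 i - t) * Z i i.
  apply: eq_bigr => i _; rewrite mulmxBl mul_diag_mx mul_scalar_mx !mxE.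
  by rewrite mulrBl.
rewrite /psi AE sum_eigenvalues // trmx_sqrE // mulr_sumr -sumrB.
apply: ler_sum => i _.
apply: le_trans (pos2_dual (d 0 i - t) (posZ i)).
rewrite mulrA lerD2l lerN2 (bigD1 i) //= lerDl sumr_ge0 // => j _.
exact: sqr_ge0.
Qed.
End PositivePart.

(** * Functional calculus, positive parts and their perturbation *)

Section SpectralCalculus.
Variables (R : rcfType) (n : nat) (P : 'M[R]_n).
Hypothesis PP : P *m P^T = 1%:M.
Implicit Types e : 'rV[R]_n.

(** The matrices diagonal in one orthonormal eigenbasis, the rows of P. Functions of
    a symmetric matrix are computed on these. *)
Definition conj_diag e := P^T *m diag_mx e *m P.

Lemma conj_diagT e : (conj_diag e)^T = conj_diag e.
Proof. by rewrite /conj_diag !trmx_mul trmxK tr_diag_mx mulmxA. Qed.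

Lemma conj_diagM e e' : conj_diag e *m conj_diag e' = conj_diag (\row_i (e 0 i * e' 0 i)).
Proof.
rewrite /conj_diag -[LHS]mulmxA (mulmxA P) (mulmxA P) PP mul1mx !mulmxA.
by rewrite -(mulmxA P^T) mulmx_diag.
Qed.

Lemma conj_diagB e e' : conj_diag e - conj_diag e' = conj_diag (\row_i (e 0 i - e' 0 i)).
Proof.
rewrite /conj_diag -mulmxBl -mulmxBr -linearB /=; congr (_ *m diag_mx _ *m _).
by apply/rowP => i; rewrite !mxE.
Qed.

Lemma conj_diag_scalar a : conj_diag (const_mx a) = a%:M.
Proof.
rewrite /conj_diag diag_const_mx -mulmxA mul_scalar_mx -scalemxAr (mulmx1C PP).
by rewrite scalemx1.
Qed.

Lemma eq_conj_diag e e' : (forall i, e 0 i = e' 0 i) -> conj_diag e = conj_diag e'.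
Proof. by move=> ee; congr (_ *m diag_mx _ *m _); apply/rowP. Qed.

Lemma trace_conj_diag e : \tr (conj_diag e) = \sum_i e 0 i.
Proof. by rewrite /conj_diag -mulmxA mxtrace_mulC -mulmxA PP mulmx1 mxtrace_diag. Qed.

Lemma conj_diag_psd e : (forall i, 0 <= e 0 i) -> psdmx (conj_diag e).
Proof.
move=> e0; split=> [|v]; first exact: conj_diagT.
have -> : qform (conj_diag e) v = qform (diag_mx e) (P *m v) by rewrite qformM.
rewrite qformE sumr_ge0 // => i _; rewrite (bigD1 i) //= big1 => [|j ji].
  by rewrite !mxE eqxx addr0 mulrAC -expr2 mulr_ge0 ?sqr_ge0 //; exact: e0.
by rewrite !mxE eq_sym (negPf ji) mulr0n mulr0 mul0r.
Qed.

End SpectralCalculus.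

Section PositivePartPerturbation.
Variable R : rcfType.

(** Z is the positive part of A - t. The last field provides the orthogonal
    projection E on the eigenvectors of A below t; the negative part
    Z - (A - t) lives there. *)
Record positive_part n (t : R) (A Z : 'M[R]_n) : Prop := PositivePart {
  pp_psd : psdmx Z;
  pp_mul : Z *m (A - t%:M) = Z *m Z;
  pp_tr : \tr (Z *m Z) = psi t A;
  pp_neg : exists E : 'M[R]_n, [/\ E^T = E, E *m E = E, Z *m E = 0 &
     (Z - (A - t%:M)) *m E = Z - (A - t%:M)] }.

Lemma positive_part_exists n (t : R) (A : 'M[R]_n) : A^T = A ->
  exists Z, positive_part t A Z.
Proof.
move=> symA; have [P [d [PP AE]]] := symmetric_diagonalization symA.
have AtE : A - t%:M = conj_diag P (\row_i (d 0 i - t)).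
  rewrite -(conj_diag_scalar PP) AE -/(conj_diag P d) conj_diagB.
  by apply: eq_conj_diag => i; rewrite !mxE.
pose z := \row_i Num.max (d 0 i - t) 0.
pose e : 'rV[R]_n := \row_i (d 0 i < t)%R%:R.
exists (conj_diag P z); split.
- by apply: conj_diag_psd => i; rewrite mxE le_max lexx orbT.
- rewrite AtE !conj_diagM //; apply: eq_conj_diag => i; rewrite !mxE.
  by case: (lerP (d 0 i - t) 0); rewrite ?mul0r.
- rewrite conj_diagM // trace_conj_diag // /psi AE sum_eigenvalues //.
  by apply: eq_bigr => i _; rewrite !mxE /pos2 expr2.
exists (conj_diag P e); split.
- exact: conj_diagT.
- by rewrite conj_diagM //; apply: eq_conj_diag => i; rewrite !mxE -natrM mulnb andbb.
- rewrite conj_diagM //; have -> : 0 = conj_diag P 0 by rewrite /conj_diag linear0 mulmx0 mul0mx.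
  apply: eq_conj_diag => i; rewrite !mxE -subr_lt0.
  by case: (ltrP (d 0 i - t) 0) => h; rewrite ?mulr0 ?(max_r (ltW h)) ?mul0r.
rewrite AtE conj_diagB conj_diagM //; apply: eq_conj_diag => i; rewrite !mxE -subr_lt0.
by case: (ltrP (d 0 i - t) 0) => h; rewrite ?mulr1 // ?(max_l h) subrr mul0r.
Qed.

(** A column of Z over a zero column of A is an eigenvector of Z for -t, which is
    negative. *)
Lemma positive_part_support n (t : R) (A Z : 'M[R]_n) j : 0 < t ->
  positive_part t A Z -> (forall i, A i j = 0) -> forall i, Z i j = 0.
Proof.
move=> t0 [[symZ posZ] ZA _ _] Aj i.
pose u := col j Z.
have Zu : Z *m u = - t *: u.
  rewrite /u colE mulmxA -ZA -mulmxA mulmxBl.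
  have -> : A *m delta_mx j 0 = 0 :> 'cV_n.
    by rewrite -colE; apply/colP => k; rewrite !mxE Aj.
  by rewrite sub0r mul_scalar_mx mulmxN -scalemxAr scaleNr.
have /eqP : qform 1%:M u = 0.
  apply/eqP; rewrite eq_le qform1_ge0 andbT.
  have := posZ u; rewrite /qform -mulmxA Zu -scalemxAr mxE mulmx1.
  by rewrite mulNr oppr_ge0 pmulr_rle0.
rewrite qform1E => /eqP u0.
have nneg k : true -> 0 <= u k 0 ^+ 2 by rewrite sqr_ge0.
by have /eqP := psumr_eq0P nneg u0 isT (i := i); rewrite sqrf_eq0 mxE => /eqP.
Qed.

Lemma psdmxD n (A B : 'M[R]_n) : psdmx A -> psdmx B -> psdmx (A + B).
Proof.
move=> [sA pA] [sB pB]; split; first by rewrite linearD /= sA sB.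
by move=> v; rewrite qformD addr_ge0.
Qed.

Lemma psdmx_sum n (I : finType) (Z : I -> 'M[R]_n) :
  (forall i, psdmx (Z i)) -> psdmx (\sum_i Z i).
Proof.
move=> psdZ; elim/big_ind: _ => //; last exact: psdmxD.
by split=> [|v]; rewrite ?trmx0 // /qform mulmx0 mul0mx mxE.
Qed.

Lemma qform_sum n (I : finType) (Z : I -> 'M[R]_n) v :
  qform (\sum_i Z i) v = \sum_i qform (Z i) v.
Proof.
elim/big_rec2: _ => [|i y X _ <-]; last by rewrite qformD.
by rewrite /qform mulmx0 mul0mx mxE.
Qed.

Lemma mxtrace_mul_outer n (A : 'M[R]_n) (w : 'cV[R]_n) :
  \tr (A *m (w *m w^T)) = qform A w.
Proof.
by rewrite mulmxA mxtrace_mulC mulmxA [_ *m w]mx11_scalar mxtrace_scalar mulr1n.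
Qed.

(** The trial matrix is the sum of the Z i and of the multiple of w w^T of trace
    norm lam. The hypothesis on w says that lam bounds from below the Rayleigh
    quotient at w of what the Z i leave over of A - t. *)
Lemma psi_ge_blocks n (t : R) (A : 'M[R]_n) (I : finType) (Z : I -> 'M[R]_n)
    (w : 'cV[R]_n) (lam : R) :
  A^T = A -> (forall i, psdmx (Z i)) ->
  (forall i j, i != j -> Z i *m Z j = 0) ->
  (forall i, \tr ((A - t%:M) *m Z i) = \tr (Z i *m Z i)) ->
  0 <= lam ->
  lam * qform 1%:M w <= qform (A - t%:M) w - \sum_i qform (Z i) w ->
  0 < qform 1%:M w ->
  \sum_i \tr (Z i *m Z i) + lam ^+ 2 <= psi t A.
Proof.
move=> symA psdZ orthZ trZ lam0 lamw w0.
set N := qform 1%:M w in lamw w0.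
pose S := \sum_i Z i; pose tau := lam / N; pose W := w *m w^T.
have tau0 : 0 <= tau by rewrite divr_ge0 // ltW.
have psdW : psdmx (tau *: W).
  split; first by rewrite linearZ /= trmx_mul trmxK.
  move=> v; rewrite /qform -scalemxAr -scalemxAl mxE mulr_ge0 //.
  rewrite /W mulmxA -(mulmxA (v^T *m w)).
  have -> : w^T *m v = (v^T *m w)^T by rewrite trmx_mul trmxK.
  exact: mulmx_tr_ge0.
have psdS := psdmx_sum psdZ.
apply: le_trans (psi_ge_trial t symA (psdmxD psdS psdW)).
rewrite -/S.
have tr1 : \tr ((A - t%:M) *m (S + tau *: W)) =
    \sum_i \tr (Z i *m Z i) + tau * qform (A - t%:M) w.
  rewrite mulmxDr mxtraceD -scalemxAr mxtraceZ mxtrace_mul_outer; congr (_ + _).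
  rewrite /S mulmx_sumr raddf_sum; apply: eq_bigr => i _; exact: trZ.
have tr2 : \tr ((S + tau *: W) *m (S + tau *: W)) =
    \sum_i \tr (Z i *m Z i) + 2 * tau * qform S w + tau ^+ 2 * N ^+ 2.
  rewrite mulmxDl !mulmxDr -!scalemxAr -!scalemxAl !mxtraceD !mxtraceZ.
  rewrite (mxtrace_mulC W S) !mxtrace_mul_outer.
  have -> : qform W w = N ^+ 2.
    rewrite /qform /W mulmxA -(mulmxA (w^T *m w)).
    have -> : w^T *m w = N%:M by rewrite [LHS]mx11_scalar /N /qform mulmx1.
    by rewrite mul_scalar_mx scale_scalar_mx mxE eqxx mulr1n expr2.
  have -> : \tr (S *m S) = \sum_i \tr (Z i *m Z i).
    rewrite /S mulmx_suml raddf_sum; apply: eq_bigr => i _ /=.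
    rewrite mulmx_sumr (bigD1 i) //= big1 ?addr0 // => j ji.
    by rewrite orthZ // eq_sym.
  ring.
rewrite tr1 tr2 /S qform_sum.
set T := \sum_i \tr _; set q := qform _ w in lamw *; set r := \sum_i _ in lamw *.
have tauN : tau * N = lam by rewrite /tau; field; rewrite gt_eqF.
have -> : tau ^+ 2 * N ^+ 2 = lam ^+ 2 by rewrite -exprMn tauN.
have h : tau * (lam * N) <= tau * (q - r) by rewrite ler_wpM2l.
have : tau * (lam * N) = lam ^+ 2 by rewrite mulrCA tauN expr2.
lra.
Qed.

(** On a vector c with A >= c c^T the negative part of A - t is small: if p is
    the squared length of the projection of c on the negative eigenspaces, it
    is at most t p - p^2 there, hence at most r (t - 1) when p <= r, 1 <= r and
    2 <= t. *)
Lemma negative_part_le n (t : R) (A Z : 'M[R]_n) (c : 'cV[R]_n) :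
  A^T = A -> 2 <= t ->
  positive_part t A Z -> (forall v, (c^T *m v) 0 0 ^+ 2 <= qform A v) ->
  1 <= qform 1%:M c ->
  qform Z c - qform (A - t%:M) c <= qform 1%:M c * (t - 1).
Proof.
move=> symA t2 [[symZ posZ] ZA _ [E [symE EE ZE NE]]] Ac r1.
set r := qform 1%:M c in r1 *.
rewrite -qformN -qformD; set N := Z - (A - t%:M) in NE *.
have symN : N^T = N. by rewrite /N linearB /= linearB /= symZ symA tr_scalar_mx.
have EN : E *m N = N by apply: trmx_inj; rewrite trmx_mul symE symN.
pose v := E *m c.
have pE : qform 1%:M v = (c^T *m v) 0 0.
  by rewrite /qform mulmx1 /v trmx_mul symE -!mulmxA (mulmxA E) EE.
set p := qform 1%:M v in pE.
have -> : qform N c = qform N v by rewrite /v qformM symE EN NE.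
have -> : qform N v = t * p - qform A v.
  rewrite /N qformD qformN qformD qformN qform_scalar -/p.
  suff -> : qform Z v = 0 by ring.
  by rewrite /v qformM symE -mulmxA ZE mulmx0 /qform mulmx0 mul0mx mxE.
have p0 : 0 <= p by exact: qform1_ge0.
have pr : p <= r.
  have := qform1_ge0 (c - v); rewrite /qform mulmx1.
  have -> : (c - v)^T = c^T - v^T by apply/matrixP => i j; rewrite !mxE.
  rewrite mulmxBl !mulmxBr.
  have -> : v^T *m c = c^T *m v by rewrite /v trmx_mul symE mulmxA.
  move: pE; rewrite /p /r /qform !mulmx1 => pE; rewrite !mxE in pE *.
  by rewrite pE; lra.
have := Ac v; rewrite -pE => Av.
apply: (@le_trans _ _ (t * p - p ^+ 2)); first by rewrite lerD2l lerN2.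
have t1 : 0 <= t - 1 by lra.
have rt : t - 1 <= r * (t - 1) by rewrite ler_peMl.
case: (lerP p 1) => p1.
  apply: le_trans rt; have : 0 <= (1 - p) * (t - 1 - p) by apply: mulr_ge0; lra.
  by lra.
have : p * (t - 1) <= r * (t - 1) by rewrite ler_wpM2r.
apply: le_trans; have : 0 <= p * (p - 1) by apply: mulr_ge0; lra.
by lra.
Qed.
End PositivePartPerturbation.

(** The nonzero spectrum of B^T B is part of that of B B^T; the comparison is
    obtained by transporting the optimal trial matrix along B. *)
Lemma psi_gram_le (R : rcfType) n k (t : R) (B : 'M[R]_(n, k)) : 0 < t ->
  psi t (B^T *m B) <= psi t (B *m B^T).
Proof.
move=> t0; have symC : (B^T *m B)^T = B^T *m B by rewrite trmx_mul trmxK.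
have symA : (B *m B^T)^T = B *m B^T by rewrite trmx_mul trmxK.
have [P [d [PP CE]]] := symmetric_diagonalization symC.
pose z i := Num.max (d 0 i - t) 0.
pose q := conj_diag P (\row_i (z i / d 0 i)).
have z_gt i : z i != 0 -> 0 < z i /\ 0 < d 0 i.
  rewrite /z; case: (lerP (d 0 i - t) 0) => [|h _]; first by rewrite eqxx.
  by split=> //; lra.
have [_ q_ge0] : psdmx q.
  apply: conj_diag_psd => i; rewrite mxE.
  have [->|/z_gt[]] := eqVneq (z i) 0; first by rewrite mul0r.
  by move=> z0 d0; rewrite divr_ge0 // ltW.
have psdY : psdmx (B *m q *m B^T).
  have qT : q^T = q by exact: conj_diagT.
  split=> [|v]; first by rewrite trmx_mul trmxK (trmx_mul B) qT mulmxA.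
  rewrite (_ : qform _ v = qform q (B^T *m v)) ?q_ge0 //.
  by rewrite /qform trmx_mul trmxK !mulmxA.
apply: le_trans (psi_ge_trial t symA psdY).
have zd i : d 0 i * (z i / d 0 i) = z i.
  have [->|/z_gt[_ d0]] := eqVneq (z i) 0; first by rewrite mul0r mulr0.
  by rewrite mulrC divfK // gt_eqF.
have Cq : B^T *m B *m q = conj_diag P (\row_i z i).
  by rewrite CE -/(conj_diag P d) conj_diagM //; apply: eq_conj_diag => i; rewrite !mxE.
have trB (M : 'M_k) : \tr (B *m M *m B^T) = \tr (B^T *m B *m M).
  by rewrite mxtrace_mulC mulmxA.
have tr2 : \tr (B *m q *m B^T *m (B *m q *m B^T)) = \sum_i z i ^+ 2.
  have -> : B *m q *m B^T *m (B *m q *m B^T) = B *m (q *m (B^T *m B *m q)) *m B^T.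
    by rewrite !mulmxA.
  rewrite trB mulmxA Cq conj_diagM // trace_conj_diag //.
  by apply: eq_bigr => i _; rewrite !mxE expr2.
have tr1 : \tr ((B *m B^T - t%:M) *m (B *m q *m B^T)) = \sum_i z i ^+ 2.
  have -> : (B *m B^T - t%:M) *m (B *m q *m B^T) =
      B *m (B^T *m B *m q - t *: q) *m B^T.
    rewrite mulmxBl mul_scalar_mx mulmxBr mulmxBl -scalemxAr -scalemxAl.
    by rewrite !mulmxA.
  rewrite trB mulmxBr -scalemxAr Cq raddfB /= linearZ /= CE -/(conj_diag P d).
  rewrite conj_diagM // !trace_conj_diag // mulr_sumr -sumrB; apply: eq_bigr => i _.
  rewrite !mxE -mulrBl; have [->|/z_gt[z0 _]] := eqVneq (z i) 0.
    by rewrite mulr0 expr0n.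
  have <- : z i = d 0 i - t by move: z0; rewrite /z; case: (lerP (d 0 i - t) 0); rewrite ?ltxx.
  by rewrite expr2.
rewrite tr1 tr2 /psi CE sum_eigenvalues // le_eqVlt; apply/orP; left; apply/eqP.
have -> : \sum_i pos2 (d 0 i - t) = \sum_i z i ^+ 2 by [].
ring.
Qed.

(** * Sums over interlacing fractions *)

Section Mixing.
Variable R : realDomainType.
Variable G : nat -> nat -> R.
Hypothesis G_mono : forall k n k' n', (0 < n)%N -> (0 < n')%N ->
  (k <= n)%N -> (k' <= n')%N -> (k * n' <= k' * n)%N -> G k' n' <= G k n.

Definition fsum n := \sum_(1 <= k < n) G k n.

(** The position of j/a in the merged list of the fractions j/a and j/b, ties
    putting j/a first. *)
Definition rankl a b j := (j + (j * b).-1 %/ a)%N.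
(** The position of j/b in the same merged list. *)
Definition rankr a b j := (j + (j * a) %/ b)%N.

Lemma ranklP a b j : (0 < a)%N -> (0 < b)%N -> (0 < j)%N ->
  exists q, [/\ rankl a b j = j + q, q * a < j * b & j * b <= q.+1 * a]%N.
Proof.
move=> a0 b0 j0; exists ((j * b).-1 %/ a)%N; split=> //.
  have := leq_divM (j * b).-1 a; nia.
have := ltn_ceil (j * b).-1 a0; nia.
Qed.

Lemma rankrP a b j : (0 < a)%N -> (0 < b)%N ->
  exists q, [/\ rankr a b j = j + q, q * b <= j * a & j * a < q.+1 * b]%N.
Proof.
move=> a0 b0; exists ((j * a) %/ b)%N; split=> //; first exact: leq_divM.
exact: ltn_ceil.
Qed.

(** Merging the fractions j/a and j/b in increasing order, rankl and rankr are
    the positions they receive; hence the positions exhaust 1, ..., a + b - 2. *)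
Lemma perm_ranks a b : (0 < a)%N -> (0 < b)%N ->
  perm_eq (map (rankl a b) (index_iota 1 a) ++ map (rankr a b) (index_iota 1 b))
          (index_iota 1 (a + b).-1).
Proof.
move=> a0 b0; set s := _ ++ _.
have us : uniq s.
  rewrite cat_uniq !map_inj_in_uniq ?iota_uniq ?andbT /=.
  - apply/hasPn => _ /mapP [j + ->]; rewrite mem_index_iota => /andP[j0 jb].
    apply/mapP => -[k]; rewrite mem_index_iota => /andP[k0 ka].
    have [q [-> q1 q2]] := ranklP a0 b0 k0.
    have [r [-> r1 r2]] := rankrP j a0 b0 => e.
    case: (leqP (k * b) (j * a)) => h.
      have : (q < j)%N by rewrite -(ltn_pmul2r a0); lia.
      have : (k < r.+1)%N by rewrite -(ltn_pmul2r b0); lia.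
      by lia.
    have : (r < k)%N by rewrite -(ltn_pmul2r b0); lia.
    have : (j < q.+1)%N by rewrite -(ltn_pmul2r a0); lia.
    by lia.
  - move=> j k; rewrite !mem_index_iota => /andP[j0 ja] /andP[k0 ka].
    have [q [-> q1 q2]] := rankrP j a0 b0.
    by have [r [-> r1 r2]] := rankrP k a0 b0; nia.
  move=> j k; rewrite !mem_index_iota => /andP[j0 ja] /andP[k0 ka].
  have [q [-> q1 q2]] := ranklP a0 b0 j0.
  by have [r [-> r1 r2]] := ranklP a0 b0 k0; nia.
have ss : {subset s <= index_iota 1 (a + b).-1}.
  move=> x; rewrite /s mem_cat => /orP[] /mapP[j jin ->];
    move: jin; rewrite !mem_index_iota => /andP[j0 ja].
    have [q [-> q1 q2]] := ranklP a0 b0 j0.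
    have : (q < b)%N by rewrite -(ltn_pmul2r a0); nia.
    by lia.
  have [q [-> q1 q2]] := rankrP j a0 b0.
  have : (q < a)%N by rewrite -(ltn_pmul2r b0); nia.
  by lia.
have sz : (size (index_iota 1 (a + b).-1) <= size s)%N.
  by rewrite size_cat !size_map !size_iota; lia.
have [_ e] := uniq_min_size us ss sz.
exact: uniq_perm us (iota_uniq _ _) e.
Qed.

Lemma sum_ranks (F : nat -> R) a b : (0 < a)%N -> (0 < b)%N ->
  \sum_(1 <= k < (a + b).-1) F k =
  \sum_(1 <= j < a) F (rankl a b j) + \sum_(1 <= j < b) F (rankr a b j).
Proof. by move=> a0 b0; rewrite -(perm_big _ (perm_ranks a0 b0)) big_cat !big_map. Qed.

(** The merged fraction at position k is at least k/(a+b). *)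
Lemma fsumD_le a b : (0 < a)%N -> (0 < b)%N ->
  fsum a + fsum b <= \sum_(1 <= k < (a + b).-1) G k (a + b).
Proof.
move=> a0 b0; rewrite (sum_ranks (fun k => G k (a + b))) //.
apply: lerD; apply: ler_sum_nat => j /andP[j0 ja].
  by have [q [-> q1 q2]] := ranklP a0 b0 j0; apply: G_mono; nia.
by have [q [-> q1 q2]] := rankrP j a0 b0; apply: G_mono; nia.
Qed.

(** The merged fraction at position k is at most (k+1)/(a+b). *)
Lemma fsumD_ge a b : (0 < a)%N -> (0 < b)%N ->
  \sum_(1 <= k < (a + b).-1) G k.+1 (a + b) <= fsum a + fsum b.
Proof.
move=> a0 b0; rewrite (sum_ranks (fun k => G k.+1 (a + b))) //.
apply: lerD; apply: ler_sum_nat => j /andP[j0 ja].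
  by have [q [-> q1 q2]] := ranklP a0 b0 j0; apply: G_mono; nia.
by have [q [-> q1 q2]] := rankrP j a0 b0; apply: G_mono; nia.
Qed.

Lemma fsum1 : fsum 1 = 0. Proof. by rewrite /fsum big_geq. Qed.

Hypothesis G_ge0 : forall k n, 0 <= G k n.

Lemma fsum_ge0 n : 0 <= fsum n. Proof. exact: sumr_ge0. Qed.

Lemma fsum_superadditive a b : (0 < a)%N -> (0 < b)%N ->
  fsum a + fsum b <= fsum (a + b).
Proof.
move=> a0 b0; apply: le_trans (fsumD_le a0 b0) _.
rewrite /fsum (@big_cat_nat _ _ _ (a + b).-1 1 (a + b)) /=; [|lia|lia].
by rewrite lerDl sumr_ge0.
Qed.

Lemma fsum_almost_subadditive a b C : (0 < a)%N -> (0 < b)%N -> (2 <= a + b)%N ->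
  G 1 (a + b) <= C -> fsum (a + b) <= fsum a + fsum b + C.
Proof.
move=> a0 b0 ab GC; apply: le_trans (_ : _ <= G 1 (a + b) + (fsum a + fsum b)) _.
  rewrite /fsum big_ltn ?lerD2l //.
  apply: le_trans (fsumD_ge a0 b0).
  by rewrite big_add1.
by rewrite addrC lerD2l.
Qed.

Lemma fsum_superadditive_seq (s : seq nat) n :
  all (leq 1) s -> (sumn s <= n)%N -> \sum_(k <- s) fsum k <= fsum n.
Proof.
elim: s n => [|a s IHs] n /=; first by rewrite big_nil fsum_ge0.
case/andP=> a0 s0 sn; rewrite big_cons.
have [n0|] := posnP (n - a); last first.
  move=> n0; have -> : n = (a + (n - a))%N by lia.
  apply: le_trans (fsum_superadditive a0 n0).
  by rewrite lerD2l IHs //; lia.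
have s_nil : s = [::] by case: s s0 sn {IHs} => //= b s /andP[]; lia.
by rewrite s_nil big_nil addr0; have -> : n = a by move: sn; rewrite s_nil /=; lia.
Qed.

Lemma fsum_almost_subadditive_seq (s : seq nat) a C :
  (0 < a)%N -> all (leq 1) s -> (forall n, (1 < n)%N -> G 1 n <= C) ->
  fsum (a + sumn s) <= fsum a + \sum_(k <- s) fsum k + C *+ size s.
Proof.
move=> a0 + GC; elim: s a a0 => [|b s IHs] a a0 /=.
  by rewrite addn0 big_nil !addr0.
case/andP=> b0 s0; rewrite addnA big_cons.
apply: le_trans (IHs (a + b)%N _ s0) _; first by lia.
rewrite mulrS.
have ab : (1 < a + b)%N by lia.
have := fsum_almost_subadditive a0 b0 ab (GC _ ab).
by move: (fsum (a + b)) (fsum a) (fsum b) (\sum_(_ <- s) _) (C *+ _) => *; lra.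
Qed.

End Mixing.

(** * Cosine sums *)

Section PathSums.
Variable R : realType.
Implicit Types (s x y : R) (k n m : nat).

Definition frac_pi k n : R := k%:R * pi / n%:R.
Definition cos2 k n : R := 2 * cos (frac_pi k n).

Lemma frac_pi_ge0 k n : 0 <= frac_pi k n.
Proof. by rewrite divr_ge0 ?mulr_ge0 ?pi_ge0. Qed.

Lemma frac_pi_le k n k' n' : (0 < n)%N -> (0 < n')%N ->
  (k * n' <= k' * n)%N -> frac_pi k n <= frac_pi k' n'.
Proof.
move=> n0 n0' kn; rewrite /frac_pi ler_pdivrMr ?ltr0n // mulrAC.
rewrite ler_pdivlMr ?ltr0n // mulrAC [leRHS]mulrAC ler_wpM2r ?pi_ge0 //.
by rewrite -!natrM ler_nat.
Qed.

Lemma frac_pi_lepi k n : (0 < n)%N -> (k <= n)%N -> frac_pi k n <= pi.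
Proof.
move=> n0 kn; have -> : pi = frac_pi 1 1 :> R by rewrite /frac_pi divr1 mul1r.
by apply: frac_pi_le => //; lia.
Qed.

Lemma le_cos x y : 0 <= x -> x <= y -> y <= pi -> cos y <= cos x :> R.
Proof.
move=> x0 xy ypi; have xpi := le_trans xy ypi; have y0 := le_trans x0 xy.
by rewrite leNgt ltr_cos ?in_itv /= ?x0 ?xpi ?y0 ?ypi // -leNgt.
Qed.

Lemma cos2_mono k n k' n' : (0 < n)%N -> (0 < n')%N ->
  (k <= n)%N -> (k' <= n')%N -> (k * n' <= k' * n)%N -> cos2 k' n' <= cos2 k n.
Proof.
move=> n0 n0' kn kn' h; rewrite /cos2 ler_pM2l //.
by rewrite le_cos ?frac_pi_ge0 ?frac_pi_le ?frac_pi_lepi.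
Qed.

Lemma cos2_le2 k n : cos2 k n <= 2.
Proof. by rewrite /cos2; have := cos_le1 (frac_pi k n); lra. Qed.

Definition path_sum s n : R := fsum (fun k n => pos2 (cos2 k n - s)) n.

Lemma path_term_mono s k n k' n' : (0 < n)%N -> (0 < n')%N ->
  (k <= n)%N -> (k' <= n')%N -> (k * n' <= k' * n)%N ->
  pos2 (cos2 k' n' - s) <= pos2 (cos2 k n - s).
Proof. by move=> *; rewrite pos2_mono // lerD2r cos2_mono. Qed.

Lemma path_sum1 s : path_sum s 1 = 0. Proof. exact: fsum1. Qed.

Lemma path_sum2 s : 0 <= s -> path_sum s 2 = 0.
Proof.
move=> s0; rewrite /path_sum /fsum big_nat1 pos2_eq0 // /cos2 /frac_pi mul1r.
by rewrite cos_pihalf mulr0 sub0r oppr_le0.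
Qed.

Lemma path_sum_ge2 s n : 2 <= s -> path_sum s n = 0.
Proof.
move=> s2; rewrite /path_sum /fsum big1 // => k _; rewrite pos2_eq0 // subr_le0.
exact: le_trans (cos2_le2 _ _) s2.
Qed.

(** The triple-angle formula at pi/3 reads (c + 1) (2 c - 1)^2 = 0. *)
Lemma cos_pi3 : cos (frac_pi 1 3) = 1 / 2.
Proof.
have lt : 0 < cos (frac_pi 1 3).
  rewrite cos_gt0_pihalf // /frac_pi; have := @pi_gt0 R; lra.
have e3 : frac_pi 1 3 *+ 2 + frac_pi 1 3 = pi by rewrite /frac_pi; field.
have := cospi R; rewrite -e3 cosD cos_mulr2n sin_mulr2n.
set c := cos _ in lt *; set d := sin _.
have cd : c ^+ 2 + d ^+ 2 = 1 := cos2Dsin2 _.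
move=> e.
have : (c + 1) * (2 * c - 1) ^+ 2 = 0.
  have d2 : d ^+ 2 = 1 - c ^+ 2 by lra.
  have : (c ^+ 2 *+ 2 - 1) * c - (c * d) *+ 2 * d = 4 * c ^+ 3 - 3 * c.
    have -> : (c * d) *+ 2 * d = 2 * c * d ^+ 2 by ring.
    by rewrite d2; ring.
  move=> e'; rewrite e' in e; lra.
move=> /eqP; rewrite mulf_eq0 sqrf_eq0 => /orP[/eqP|/eqP]; lra.
Qed.

Lemma path_sum3 s : 1 <= s -> path_sum s 3 = 0.
Proof.
move=> s1; rewrite /path_sum /fsum big_nat_recl // big_nat1.
have h1 : cos2 1 3 = 1 by rewrite /cos2 cos_pi3; field.
have h2 : cos2 2 3 <= cos2 1 3 by apply: cos2_mono.
by rewrite !pos2_eq0 ?addr0 //; lra.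
Qed.

Lemma cos2_inj n k k' : (0 < n)%N -> (k <= n)%N -> (k' <= n)%N ->
  cos2 k n = cos2 k' n -> k = k'.
Proof.
move=> n0 kn kn' /(congr1 (fun x => x / 2)); rewrite /cos2.
have e (u : R) : 2 * u / 2 = u by field.
rewrite !e => /cos_inj.
have mem l : (l <= n)%N -> frac_pi l n \in `[0, pi].
  by move=> ln; rewrite in_itv /= frac_pi_ge0 frac_pi_lepi.
move=> /(_ (mem _ kn) (mem _ kn')) /(mulIf _) E; apply/eqP.
have /E /(mulIf _) E' : n%:R^-1 != 0 :> R by rewrite invr_eq0 pnatr_eq0 -lt0n.
have /E' /eqP : pi != 0 :> R by rewrite gt_eqF ?pi_gt0.
by rewrite eqr_nat.
Qed.

Lemma frac_piK k n : (0 < n)%N -> n%:R * frac_pi k n = pi *+ k.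
Proof.
by move=> n0; rewrite /frac_pi -[RHS]mulr_natl mulrC divfK // pnatr_eq0 -lt0n.
Qed.

Lemma sin_natpi k : sin (pi *+ k) = 0 :> R.
Proof. by rewrite -[_ *+ k]add0r (alternatingn (@sinDpi R)) sin0 mulr0. Qed.

(** Multiplied by 2 sin a, the sum telescopes. *)
Lemma sum_cos_arith (a : R) n : sin a != 0 -> sin (n%:R * a) = 0 ->
  \sum_(0 <= k < n) cos (k%:R * (a *+ 2)) = 0.
Proof.
move=> sa sna.
have H m : 2 * sin a * (\sum_(0 <= k < m) cos (k%:R * (a *+ 2))) =
    sin (m%:R * (a *+ 2) - a) + sin a.
  elim: m => [|m IHm]; first by rewrite big_geq // mulr0 mul0r sub0r sinN addNr.
  rewrite big_nat_recr //= mulrDr IHm.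
  have -> : m.+1%:R * (a *+ 2) - a = m%:R * (a *+ 2) + a by rewrite -natr1; ring.
  by rewrite sinB sinD; ring.
have : 2 * sin a * (\sum_(0 <= k < n) cos (k%:R * (a *+ 2))) = 0.
  rewrite H; have -> : n%:R * (a *+ 2) = (n%:R * a) *+ 2 by rewrite mulrnAr.
  by rewrite sinB sin_mulr2n cos_mulr2n cos2sin2 sna; ring.
by move=> /eqP; rewrite !mulf_eq0 (negPf sa) pnatr_eq0 /= => /eqP.
Qed.

Lemma sum_cos_frac j n : (0 < j)%N -> (j < n)%N ->
  \sum_(0 <= k < n) cos (k%:R * (frac_pi j n *+ 2)) = 0.
Proof.
move=> j0 jn; have n0 : (0 < n)%N by lia.
apply: sum_cos_arith.
  rewrite gt_eqF // sin_gt0_pi // divr_gt0 ?mulr_gt0 ?pi_gt0 ?ltr0n //=.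
  by rewrite /frac_pi ltr_pdivrMr ?ltr0n // mulrC ltr_pM2l ?pi_gt0 ?ltr_nat.
by rewrite frac_piK // sin_natpi.
Qed.

Lemma sum_half (F : R -> R) n : (0 < n)%N ->
  \sum_(1 <= k < n) F (cos2 k n) = \sum_(1 <= k < n) F (- cos2 k n).
Proof.
move=> n0; rewrite [LHS]big_nat_rev /=.
rewrite big_nat_cond [RHS]big_nat_cond; apply: eq_bigr => k /andP[/andP[k0 kn] _].
rewrite add1n subSS; congr F; rewrite /cos2 -mulrN; congr (_ * _).
have -> : frac_pi (n - k) n = - frac_pi k n + pi.
  rewrite /frac_pi natrB ?(ltnW kn) //; field.
  by rewrite pnatr_eq0 -lt0n.
by rewrite cosDpi cosN.
Qed.

(** The power sum over the positive half of the spectrum of a path. The symmetry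
    k -> n - k makes it half of the full power sum when e is even. *)
Definition even_sum (e : nat) n : R := \sum_(1 <= k < n) Num.max (cos2 k n) 0 ^+ e.

Lemma even_sum_double e n : (0 < n)%N -> (0 < e)%N -> ~~ odd e ->
  2 * even_sum e n = \sum_(1 <= k < n) cos2 k n ^+ e.
Proof.
move=> n0 e0 ev.
have -> : 2 * even_sum e n = even_sum e n + even_sum e n by ring.
rewrite {2}/even_sum (sum_half (fun x => Num.max x 0 ^+ e)) // /even_sum -big_split /=.
apply: eq_bigr => k _; set c := cos2 _ _.
case: (lerP c 0) => c0; [rewrite (max_l (_ : 0 <= - c)) ?oppr_ge0 //|].
  by rewrite expr0n gtn_eqF // add0r exprNn -signr_odd (negPf ev) mul1r.
rewrite (max_r (_ : - c <= 0)) ?oppr_le0 ?(ltW c0) //.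
by rewrite expr0n gtn_eqF // addr0.
Qed.

Lemma cos2_sqr k n : cos2 k n ^+ 2 = 2 + 2 * cos (k%:R * (frac_pi 1 n *+ 2)).
Proof.
have -> : k%:R * (frac_pi 1 n *+ 2) = frac_pi k n *+ 2.
  by rewrite /frac_pi mulrnAr mul1r mulrA.
by rewrite cos_mulr2n /cos2; ring.
Qed.

Lemma cos2_four k n : cos2 k n ^+ 4 =
  6 + 8 * cos (k%:R * (frac_pi 1 n *+ 2)) + 2 * cos (k%:R * (frac_pi 2 n *+ 2)).
Proof.
have -> : k%:R * (frac_pi 1 n *+ 2) = frac_pi k n *+ 2.
  by rewrite /frac_pi mulrnAr mul1r mulrA.
have -> : k%:R * (frac_pi 2 n *+ 2) = frac_pi k n *+ 2 *+ 2.
  by rewrite /frac_pi !mulrnAr; congr (_ *+ 2); rewrite -mulrnAr; ring.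
by rewrite !cos_mulr2n /cos2; ring.
Qed.

Lemma even_sum2 n : (2 <= n)%N -> even_sum 2 n = n%:R - 2.
Proof.
move=> n2; have := even_sum_double (e := 2) (n := n); rewrite (ltnW n2) => /(_ isT isT isT).
have : \sum_(0 <= k < n) cos2 k n ^+ 2 = 2 * n%:R.
  under eq_bigr do rewrite cos2_sqr.
  rewrite big_split /= -mulr_sumr sum_cos_frac // mulr0 addr0 sumr_const_nat.
  by rewrite subn0 mulr_natr.
rewrite big_ltn; last by lia.
have -> : cos2 0 n = 2 by rewrite /cos2 /frac_pi !mul0r cos0 mulr1.
lra.
Qed.

Lemma even_sum4 n : (3 <= n)%N -> even_sum 4 n = 3 * n%:R - 8.
Proof.
move=> n2; have := even_sum_double (e := 4) (n := n); rewrite (ltn_trans _ n2) // => /(_ isT isT isT).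
have : \sum_(0 <= k < n) cos2 k n ^+ 4 = 6 * n%:R.
  under eq_bigr do rewrite cos2_four.
  rewrite 2!big_split /= -!mulr_sumr !sum_cos_frac //; last by lia.
  by rewrite !mulr0 !addr0 sumr_const_nat subn0 mulr_natr.
rewrite big_ltn; last by lia.
have -> : cos2 0 n = 2 by rewrite /cos2 /frac_pi !mul0r cos0 mulr1.
lra.
Qed.

Lemma even_sum_ge0 e n : 0 <= even_sum e n.
Proof. by rewrite sumr_ge0 // => k _; rewrite exprn_ge0 // le_max lexx orbT. Qed.

Lemma even_sum2_ge m : m%:R - 1 <= even_sum 2 m.+1.
Proof.
case: m => [|m]; first by have := even_sum_ge0 2 1; lra.
by rewrite even_sum2 // -[m.+2%:R]natr1; lra.
Qed.

Lemma even_sum4_ge m : 3 * m%:R - 5 <= even_sum 4 m.+1.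
Proof.
case: m => [|[|m]].
- by have := even_sum_ge0 4 1; lra.
- by have := even_sum_ge0 4 2; lra.
by rewrite even_sum4 // -[m.+3%:R]natr1; lra.
Qed.

End PathSums.

(** * The loss in cutting a path *)

Section PathPieces.
Variable R : realType.
Implicit Types (s t x : R) (k n m : nat) (ms : seq nat).

Section Majorant.
Variables s al be : R.
Hypotheses (s0 : 0 <= s) (al0 : 0 <= al) (be0 : 0 <= be).
Hypothesis maj : forall v : R, 0 <= v -> v <= 2 -> v - s <= al * v + 2 * be * v ^+ 3.

(** The gap between al u^2 + be u^4, cut off at 0, and (u - s)_+^2. By the hypothesis
    [maj] on derivatives it is nondecreasing on (-oo, 2], so that its path sums are
    superadditive. *)
Definition excess u : R :=
  al * Num.max u 0 ^+ 2 + be * Num.max u 0 ^+ 4 - pos2 (u - s).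

(** For s <= x <= y the increment of the quartic is (y - x) times its derivative at
    the midpoint, plus a nonnegative term since the derivative is convex; the
    increment of the square is (y - x) times its derivative at the midpoint. Hence
    [maj] at midpoints suffices. *)
Lemma excess_mono (u u' : R) : u <= u' -> u' <= 2 -> excess u <= excess u'.
Proof.
have [s_ge0 [al_ge0 be_ge0]] : 0 <= s /\ 0 <= al /\ 0 <= be by [].
have pm (x y : R) : 0 <= x -> x <= y -> al * x ^+ 2 + be * x ^+ 4 <= al * y ^+ 2 + be * y ^+ 4.
  move=> x0 xy; have y0 := le_trans x0 xy.
  by rewrite lerD // ler_wpM2l // lerXn2r // nnegrE.
have key (x y : R) : s <= x -> x <= y -> y <= 2 ->
    (y - s) ^+ 2 - (x - s) ^+ 2 <=
    al * y ^+ 2 + be * y ^+ 4 - (al * x ^+ 2 + be * x ^+ 4).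
  move=> sx xy y2; have v0 : 0 <= (x + y) / 2 by lra.
  have v2 : (x + y) / 2 <= 2 by lra.
  have h := maj v0 v2; rewrite -subr_ge0.
  have -> : al * y ^+ 2 + be * y ^+ 4 - (al * x ^+ 2 + be * x ^+ 4) -
     ((y - s) ^+ 2 - (x - s) ^+ 2) = (y - x) *
     (2 * (al * ((x + y) / 2) + 2 * be * ((x + y) / 2) ^+ 3 - ((x + y) / 2 - s))
      + be * (x + y) * ((x - y) ^+ 2 / 2)) by field.
  apply: mulr_ge0; first by lra.
  apply: addr_ge0; first by lra.
  have xy0 : 0 <= x + y by lra.
  by rewrite mulr_ge0 // ?divr_ge0 ?sqr_ge0 // mulr_ge0.
move=> uu' u'2; rewrite /excess.
have mm : Num.max u 0 <= Num.max u' 0 by rewrite ge_max !le_max uu' lexx orbT.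
have m0 : 0 <= Num.max u 0 by rewrite le_max lexx orbT.
case: (lerP u' s) => u's.
  by rewrite !pos2_eq0 ?subr0 ?pm //; lra.
have u'0 : 0 <= u' by lra.
rewrite (pos2E (_ : 0 <= u' - s)); last by lra.
rewrite (max_l u'0) in mm *.
case: (lerP u s) => us.
  rewrite pos2_eq0 ?subr_le0 // subr0.
  have mus : Num.max u 0 <= s by rewrite ge_max us s0.
  by have := pm _ _ m0 mus; have := key s u' (lexx s) (ltW u's) u'2; lra.
have u0 : 0 <= u by lra.
rewrite (max_l u0) pos2E; last by lra.
by have := key u u' (ltW us) uu' u'2; lra.
Qed.

Lemma excess_ge0 (u : R) : u <= 2 -> 0 <= excess u.
Proof.
have s_ge0 := s0; move=> u2; have <- : excess (Num.min u 0) = 0.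
  have h : Num.min u 0 <= 0 by rewrite ge_min lexx orbT.
  by rewrite /excess (max_r h) !expr0n /= !mulr0 pos2_eq0 ?subrr ?addr0 //; lra.
by apply: excess_mono; rewrite // ge_min lexx.
Qed.

(** Superadditivity of the path sums of [excess] turns the loss of [path_sum] into
    a loss of the power sums of order 2 and 4, which are affine in the number of
    vertices, apart from the smallest numbers. *)
Lemma path_sum_poly ms : (size ms <= 4)%N ->
  path_sum s (4 + sumn ms) <= \sum_(m <- ms) path_sum s m.+1 +
    (al * (2 + (size ms)%:R) + be * (4 + 5 * (size ms)%:R)).
Proof.
move=> q4; pose G k n := excess (cos2 R k n).
have fsumG n : fsum G n = al * even_sum R 2 n + be * even_sum R 4 n - path_sum s n.
  rewrite /fsum /even_sum /path_sum /fsum !mulr_sumr -sumrN -!big_split /=.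
  by apply: eq_bigr.
have Gm k n k' n' : (0 < n)%N -> (0 < n')%N -> (k <= n)%N -> (k' <= n')%N ->
    (k * n' <= k' * n)%N -> G k' n' <= G k n.
  by move=> *; apply: excess_mono; [exact: cos2_mono | exact: cos2_le2].
have G0 k n : 0 <= G k n by apply: excess_ge0; exact: cos2_le2.
have := @fsum_superadditive_seq _ G Gm G0 (map S ms) (4 + sumn ms).
have -> : all (leq 1) (map S ms) by apply/allP => _ /mapP[m _ ->].
have -> : (sumn (map S ms) <= 4 + sumn ms)%N.
  have -> : sumn (map S ms) = (size ms + sumn ms)%N.
    by elim: (ms) => //= m l ->; lia.
  by rewrite leq_add2r.
move=> /(_ isT isT); rewrite big_map fsumG.
under eq_bigr do rewrite fsumG.
rewrite sumrB big_split /= -!mulr_sumr.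
have -> : even_sum R 2 (4 + sumn ms) = 2 + (sumn ms)%:R.
  by rewrite even_sum2 // natrD; lra.
have -> : even_sum R 4 (4 + sumn ms) = 4 + 3 * (sumn ms)%:R.
  by rewrite even_sum4 // natrD; lra.
have h2 : (sumn ms)%:R - (size ms)%:R <= \sum_(m <- ms) even_sum R 2 m.+1.
  elim: (ms) => [|m l IHl]; first by rewrite big_nil subrr.
  by rewrite big_cons /= natrD -natr1; have := even_sum2_ge R m; lra.
have h4 : 3 * (sumn ms)%:R - 5 * (size ms)%:R <= \sum_(m <- ms) even_sum R 4 m.+1.
  elim: (ms) => [|m l IHl]; first by rewrite big_nil !mulr0 subrr.
  by rewrite big_cons /= natrD -natr1; have := even_sum4_ge R m; lra.
have := ler_wpM2l al0 h2; have := ler_wpM2l be0 h4; lra.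
Qed.
End Majorant.

(** Merging paths one after another; each merger costs at most the largest possible
    term, pos2 (2 - s). *)
Lemma path_sum_jump s ms ns : (0 < size (ms ++ ns))%N -> all (leq 1) ns ->
  path_sum s (sumn (map S ms ++ ns)) <=
  \sum_(m <- ms) path_sum s m.+1 + \sum_(n <- ns) path_sum s n +
  pos2 (2 - s) *+ (size ms + size ns).-1.
Proof.
move=> l0 ns1.
pose G k n := pos2 (cos2 R k n - s).
have Gm := @path_term_mono R s.
have GC n : (1 < n)%N -> G 1 n <= pos2 (2 - s).
  by move=> _; rewrite pos2_mono // lerD2r cos2_le2.
rewrite -(big_map S predT (path_sum s)) -big_cat /=.
have -> : (size ms + size ns)%N = size (map S ms ++ ns) by rewrite size_cat size_map.
have : all (leq 1) (map S ms ++ ns).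
  by rewrite all_cat ns1 andbT; apply/allP => _ /mapP[m _ ->].
have : map S ms ++ ns != [::].
  by move: l0; rewrite -!size_eq0 !size_cat size_map -lt0n.
case: (map S ms ++ ns) => // a l _ /andP[a1 al1].
by rewrite big_cons; exact: (@fsum_almost_subadditive_seq R G Gm).
Qed.

Lemma sumn_mapS ms : sumn (map S ms) = (size ms + sumn ms)%N.
Proof. by elim: ms => //= m l ->; lia. Qed.

(** The cubic touches the line at v = 3/2. Rescaled, this gives majorants
    v - s <= al v + 2 be v^3 of the required form. *)
Lemma cubic_majorant (v : R) : 0 <= v -> v <= 1 + 4 / 27 * v ^+ 3.
Proof.
move=> v0; rewrite -subr_ge0.
have -> : 1 + 4 / 27 * v ^+ 3 - v = 4 / 27 * ((v - 3 / 2) ^+ 2 * (v + 3)) by field.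
have v3 : 0 <= v + 3 by lra.
by have := mulr_ge0 (sqr_ge0 (v - 3 / 2)) v3; lra.
Qed.

(** Three ranges of s use three majorants. For s <= 1 a quadratic term is worth having.
    Above that a pure quartic is better, in contact at v = 3 s / 2; this point
    reaches 2 at s = 4/3, and from there on contact at v = 2 gives a smaller
    coefficient. *)
Lemma path_sum_poly_small s ms : 0 <= s -> s <= 1 -> (size ms <= 4)%N ->
  path_sum s (4 + sumn ms) <= \sum_(m <- ms) path_sum s m.+1 +
    ((1 - s) * (2 + (size ms)%:R) + 2 / 27 * s * (4 + 5 * (size ms)%:R)).
Proof.
move=> s0 s1 q4; apply: path_sum_poly => //; [lra|lra|].
move=> v v0 v2; have := ler_wpM2l s0 (cubic_majorant v0); lra.
Qed.

Lemma path_sum_poly_mid s ms : 1 <= s -> (size ms <= 4)%N ->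
  path_sum s (4 + sumn ms) <= \sum_(m <- ms) path_sum s m.+1 +
    2 / 27 / s ^+ 2 * (4 + 5 * (size ms)%:R).
Proof.
move=> s1 q4; have s0 : 0 < s by lra.
have b0 : 0 <= 2 / 27 / s ^+ 2 by rewrite ltW // divr_gt0 ?exprn_gt0 //; lra.
have maj (v : R) : 0 <= v -> v <= 2 -> v - s <= 0 * v + 2 * (2 / 27 / s ^+ 2) * v ^+ 3.
  move=> v0 v2; have vs0 : 0 <= v / s by rewrite divr_ge0 // ltW.
  have := ler_wpM2l (ltW s0) (cubic_majorant vs0).
  have -> : s * (v / s) = v by field; rewrite gt_eqF.
  have -> : s * (1 + 4 / 27 * (v / s) ^+ 3) = s + 2 * (2 / 27 / s ^+ 2) * v ^+ 3.
    by field; rewrite gt_eqF.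
  lra.
by have := path_sum_poly (ltW s0) (lexx 0) b0 maj q4; rewrite mul0r add0r.
Qed.

Lemma path_sum_poly_large s ms : 4 / 3 <= s -> s <= 2 -> (size ms <= 4)%N ->
  path_sum s (4 + sumn ms) <= \sum_(m <- ms) path_sum s m.+1 +
    (2 - s) / 16 * (4 + 5 * (size ms)%:R).
Proof.
move=> s1 s2 q4; have s0 : 0 < s by lra.
have b0 : 0 <= (2 - s) / 16 by lra.
have maj (v : R) : 0 <= v -> v <= 2 -> v - s <= 0 * v + 2 * ((2 - s) / 16) * v ^+ 3.
  move=> v0 v2; rewrite -subr_ge0.
  have -> : 0 * v + 2 * ((2 - s) / 16) * v ^+ 3 - (v - s) =
    (2 - v) * (1 - (2 - s) * (4 + 2 * v + v ^+ 2) / 8) by field.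
  apply: mulr_ge0; first by lra.
  have h : v ^+ 2 <= 4.
    by have := mulr_ge0 v0 (_ : 0 <= 2 - v); rewrite subr_ge0 => /(_ v2); lra.
  have h2 : 0 <= 2 - s by lra.
  have h3 : 4 + 2 * v + v ^+ 2 <= 12 by lra.
  by have := ler_wpM2l h2 h3; lra.
by have := path_sum_poly (ltW s0) (lexx 0) b0 maj q4; rewrite mul0r add0r.
Qed.

(** In the four estimates ms lists the sizes of the pieces left by a claw. The
    constants 254/91, 251/109, 117/53 and 2 are the values of lam reached in
    [psi_claw] with at most four, three, two and at most one pieces. *)
Lemma path_sum_le4 s ms : 0 <= s -> s <= 2 -> (size ms <= 4)%N ->
  path_sum s (4 + sumn ms) <= \sum_(m <- ms) path_sum s m.+1 + (254 / 91 - s) ^+ 2.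
Proof.
move=> s0 s2 q4; case: (lerP s 1) => s1.
  apply: le_trans (path_sum_poly_small s0 s1 q4) _; rewrite lerD2l.
  have q4' : (size ms)%:R <= 4%:R :> R by rewrite ler_nat.
  have c0 : 0 <= 1 - s + 10 / 27 * s by lra.
  have := ler_wpM2l c0 q4'; have := sqr_ge0 (s - 2 / 3); lra.
pose ns := nseq (4 - size ms) 1%N.
have ns1 : all (leq 1) ns by apply/allP => x; rewrite mem_nseq => /andP[_ /eqP->].
have sns : size ns = (4 - size ms)%N by rewrite size_nseq.
have l0 : (0 < size (ms ++ ns))%N by rewrite size_cat sns; lia.
have := path_sum_jump s l0 ns1; rewrite sns subnKC //.
have -> : sumn (map S ms ++ ns) = (4 + sumn ms)%N.
  by rewrite sumn_cat sumn_mapS sumn_nseq; lia.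
have -> : \sum_(n <- ns) path_sum s n = 0.
  by rewrite big_nseq; elim: (4 - size ms)%N => //= k ->; rewrite path_sum1 addr0.
move=> h; apply: le_trans h _; rewrite addr0 lerD2l pos2E; last by lra.
have h : 0 <= (2 - s) * (s - 1) by apply: mulr_ge0; lra.
rewrite -mulr_natl /=; lra.
Qed.

Lemma path_sum_le3 s ms : 0 <= s -> s <= 2 -> size ms = 3 ->
  path_sum s (4 + sumn ms) <= \sum_(m <- ms) path_sum s m.+1 + (251 / 109 - s) ^+ 2.
Proof.
move=> s0 s2 q3; have q4 : (size ms <= 4)%N by rewrite q3.
case: (lerP s 1) => s1.
  apply: le_trans (path_sum_poly_small s0 s1 q4) _; rewrite lerD2l q3.
  have := sqr_ge0 (s - 1/2); lra.
case: (lerP s (3 / 2)) => s32.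
  apply: le_trans (path_sum_poly_mid (ltW s1) q4) _; rewrite lerD2l q3.
  have -> : 2 / 27 / s ^+ 2 * (4 + 5 * 3) = (38 / 27) / s ^+ 2 by field; lra.
  rewrite ler_pdivrMr ?exprn_gt0 //; last by lra.
  rewrite -exprMn.
  have h : 12 / 10 <= (251 / 109 - s) * s by nra.
  have : (12 / 10) ^+ 2 <= ((251 / 109 - s) * s) ^+ 2 by rewrite lerXn2r // nnegrE; lra.
  lra.
have s43 : 4 / 3 <= s by lra.
apply: le_trans (path_sum_poly_large s43 s2 q4) _; rewrite lerD2l q3.
have := sqr_ge0 ((2 - s) - 3/10); lra.
Qed.

Lemma path_sum_le2 s ms : 0 <= s -> s <= 2 -> size ms = 2 ->
  path_sum s (4 + sumn ms) <= \sum_(m <- ms) path_sum s m.+1 + (117 / 53 - s) ^+ 2.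
Proof.
move=> s0 s2 q2; have q4 : (size ms <= 4)%N by rewrite q2.
case: (lerP s 1) => s1.
  apply: le_trans (path_sum_poly_small s0 s1 q4) _; rewrite lerD2l q2.
  have := sqr_ge0 (s - 3/4); lra.
case: (lerP s (3 / 2)) => s32.
  apply: le_trans (path_sum_poly_mid (ltW s1) q4) _; rewrite lerD2l q2.
  have -> : 2 / 27 / s ^+ 2 * (4 + 5 * 2) = (28 / 27) / s ^+ 2 by field; lra.
  rewrite ler_pdivrMr ?exprn_gt0 //; last by lra.
  rewrite -exprMn.
  have h : 103 / 100 <= (117 / 53 - s) * s by nra.
  have : (103 / 100) ^+ 2 <= ((117 / 53 - s) * s) ^+ 2 by rewrite lerXn2r // nnegrE; lra.
  lra.
have := @path_sum_jump s ms [:: 2%N]; rewrite size_cat q2 => /(_ isT isT).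
rewrite sumn_cat sumn_mapS q2 big_seq1 path_sum2 // addr0.
have -> : (2 + sumn ms + sumn [:: 2])%N = (4 + sumn ms)%N by rewrite /=; lia.
move=> h; apply: le_trans h _; rewrite lerD2l /= mulr2n pos2E; last by lra.
nra.
Qed.

Lemma path_sum_le1 s ms : 0 <= s -> s <= 2 -> (size ms <= 1)%N ->
  path_sum s (4 + sumn ms) <= \sum_(m <- ms) path_sum s m.+1 + (2 - s) ^+ 2.
Proof.
move=> s0 s2 q1; have q4 : (size ms <= 4)%N by lia.
case: ms q1 q4 => [|m [|//]] _ q4.
  have := @path_sum_jump s [::] [:: 2%N; 2%N] isT isT.
  by rewrite !big_cons !big_nil /= path_sum2 // !addr0 pos2E //; lra.
case: (lerP s 1) => s1.
  apply: le_trans (path_sum_poly_small s0 s1 q4) _; rewrite lerD2l /=.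
  have := sqr_ge0 (s - 5/6); lra.
have := @path_sum_jump s [:: m] [:: 3%N] isT isT.
rewrite !big_cons !big_nil /= path_sum3 ?(ltW s1) // !addr0 pos2E; last by lra.
by have -> : (m.+1 + (3 + 0))%N = (4 + (m + 0))%N by lia.
Qed.
End PathPieces.

(** * A cycle dominates a path *)

Section CycleVsPath.
Import numFieldNormedType.Exports.
Variable R : realType.
Implicit Types (s t x y : R) (k n m i : nat).

Lemma sin_slope x y : 0 <= x -> x <= y -> exists c,
  [/\ x <= c, c <= y & sin y - sin x = cos c * (y - x)].
Proof.
move=> x0 xy.
have der z : z \in `]x, y[ -> is_derive z 1 (@sin R) (cos z) by move=> _; exact: is_derive_sin.
have [|c + e] := MVT_segment xy der; first exact/continuous_subspaceT/continuous_sin.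
by rewrite in_itv /= => /andP[xc cy]; exists c.
Qed.

Lemma sin_le x : 0 <= x -> sin x <= x.
Proof.
move=> x0; have [c [c0 cx]] := sin_slope (lexx 0) x0.
by rewrite sin0 !subr0 => ->; rewrite -[leRHS]mul1r ler_wpM2r ?cos_le1.
Qed.

(** Chords of the sine through the origin become flatter. *)
Lemma sin_concave x y : 0 <= x -> x <= y -> y <= pi -> x * sin y <= y * sin x.
Proof.
move=> x0 xy ypi.
have [c [c0 cx]] := sin_slope (lexx 0) x0; rewrite sin0 !subr0 => sx.
have [d [xd dy]] := sin_slope x0 xy => sy.
have cd : cos d <= cos c.
  by apply: le_cos => //; [exact: le_trans xd | exact: le_trans ypi].
have -> : sin y = sin x + cos d * (y - x) by rewrite -sy addrC subrK.
rewrite sx; have := ler_wpM2r (mulr_ge0 x0 (_ : 0 <= y - x)) cd.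
rewrite subr_ge0 => /(_ xy); lra.
Qed.

Lemma sin_pi6 : sin (pi / 6) = 1 / 2 :> R.
Proof.
have -> : pi / 6 = - frac_pi R 1 3 + pi / 2 by rewrite /frac_pi; field.
by rewrite sinDpihalf cosN cos_pi3.
Qed.

(** The slope of the sine on [0, pi/6] is at least cos (pi/6) > 6/7, and
    sin (pi/6) = 1/2. *)
Lemma pi_le_7half : pi <= 7 / 2 :> R.
Proof.
have p6 : 0 <= pi / 6 :> R by have := @pi_ge0 R; lra.
have [c [c0 cx]] := sin_slope (lexx 0) p6; rewrite sin0 !subr0 sin_pi6 => e.
have cc : cos (pi / 6) <= cos c by apply: le_cos => //; have := @pi_ge0 R; lra.
have c6 : cos (pi / 6) ^+ 2 = 3 / 4 :> R by rewrite cos2sin2 sin_pi6; field.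
have cg : 12 / 14 <= cos (pi / 6) :> R.
  have h : 0 < cos (pi / 6) :> R.
    by apply: cos_gt0_pihalf; have := @pi_gt0 R; lra.
  rewrite leNgt; apply/negP => lt.
  have : cos (pi / 6) ^+ 2 < (12 / 14) ^+ 2 :> R by rewrite ltrXn2r // ltW.
  by rewrite c6; lra.
have : 12 / 14 * (pi / 6) <= cos c * (pi / 6) by rewrite ler_wpM2r //; lra.
rewrite -e; lra.
Qed.

(** For M = m, x = pi/m and y = pi/(m+1). On the left one sine is at most 1 and the
    other at most its angle. On the right chords from the origin bound the sines
    from below: the chord up to pi/2 if I >= 2, while for I = 1 both angles equal
    y <= pi/6 and the steeper chord up to pi/6 is needed, with pi <= 7/2. *)
Lemma sine_products (M I x y : R) :
  0 < y -> y <= x -> M * x = pi -> (M + 1) * y = pi ->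
  I = 1 \/ 2 <= I -> 8 * I - 2 <= M ->
  sin (2 * I * (x + y)) * sin (2 * I * (x - y)) <=
  sin ((2 * I - 1) * y + (2 * I - 2) * x) * sin ((2 * I - 1) * y - (2 * I - 2) * x).
Proof.
move=> y0 yx xE yE I12 MI.
have pi0 := @pi_gt0 R.
have I1 : 1 <= I by lra.
have xyE : M * (x - y) = y by lra.
have Q2 : (4 * I - 1) * y <= pi / 2.
  have : (8 * I - 2) * y <= (M + 1) * y by rewrite ler_wpM2r ?(ltW y0) //; lra.
  rewrite yE; lra.
have ypi : y <= pi by have : 0 <= M * y by [apply: mulr_ge0; lra]; lra.
set M1 := (2 * I - 1) * y + _; set D1 := (2 * I - 1) * y - _.
set M2 := 2 * I * (x + y); set D2 := 2 * I * (x - y).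
have D2p : 0 <= D2 by rewrite /D2 !mulr_ge0 //; lra.
have D2pi : D2 <= pi.
  by rewrite /D2; have : 2 * I * (x - y) <= M * (x - y) by [rewrite ler_wpM2r //; lra]; rewrite xyE; lra.
apply: le_trans (_ : D2 <= _).
  have sD2 : 0 <= sin D2 by apply: sin_ge0_pi; rewrite D2p.
  by apply: le_trans (sin_le D2p); rewrite -[leRHS]mul1r ler_wpM2r ?sin_le1.
have D1E : D1 = (M - 2 * I + 2) * (x - y) by rewrite /D1; lra.
have d0 : 0 <= x - y by lra.
have pi7 := pi_le_7half.
case: I12 => [I1E|I2].
  have M6 : 6 <= M by move: MI; rewrite I1E; lra.
  have -> : M1 = y by rewrite /M1 I1E; ring.
  have -> : D1 = y by rewrite D1E I1E -[RHS]xyE; ring.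
  have y6 : y <= pi / 6.
    have : 6 * y <= (M + 1) * y by rewrite ler_wpM2r ?(ltW y0) //; lra.
    rewrite yE; lra.
  have := sin_concave (ltW y0) y6 (_ : pi / 6 <= pi); rewrite sin_pi6 => h.
  have {}h : 3 * y <= pi * sin y by have := h ltac:(lra); lra.
  have s0 : 0 <= sin y by apply: sin_ge0_pi; lra.
  have h2 : (3 * y) ^+ 2 <= (pi * sin y) ^+ 2.
    have a0 : 0 <= 3 * y by lra.
    have b0 : 0 <= pi * sin y by rewrite mulr_ge0 // ltW.
    by rewrite lerXn2r.
  have M0 : 0 < M by lra.
  have MD : M * D2 = 2 * y by rewrite /D2 I1E -[in RHS]xyE; ring.
  have h3 : pi ^+ 2 * 2 <= 9 * (M * y) :> R.
    have : pi * pi <= 7 / 2 * pi :> R by rewrite ler_wpM2r // ltW.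
    have : 7 * y <= 2 * M * y by rewrite ler_wpM2r ?(ltW y0) //; lra.
    have : 7 * pi = 7 * (M * y) + 7 * y by rewrite -yE; ring.
    lra.
  have h4 : y * (pi ^+ 2 * 2) <= y * (9 * (M * y)) by rewrite ler_wpM2l // ltW.
  have h5 : M * (3 * y) ^+ 2 <= M * (pi * sin y) ^+ 2 by rewrite ler_wpM2l // ltW.
  have pM : 0 < pi ^+ 2 * M by rewrite mulr_gt0 // exprn_gt0.
  rewrite -(ler_pM2l pM) -mulrA MD; lra.
have xy2 : (2 * I - 2) * (x - y) <= M * (x - y) by rewrite ler_wpM2r //; lra.
have M1Q : M1 <= (4 * I - 1) * y by rewrite /M1; lra.
have D1_ge0 : 0 <= D1 by rewrite D1E mulr_ge0 //; lra.
have D1M1 : D1 <= M1.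
  rewrite /D1 /M1; have : 0 <= (2 * I - 2) * x by apply: mulr_ge0; lra.
  lra.
have chord z : 0 <= z -> z <= M1 -> z <= pi / 2 * sin z.
  move=> z0 zM; have zp : z <= pi / 2 by lra.
  have := sin_concave z0 zp; rewrite sin_pihalf mulr1; apply; lra.
have hM := chord M1 (le_trans D1_ge0 D1M1) (lexx _).
have hD := chord D1 D1_ge0 D1M1.
have hMD : M1 * D1 <= pi / 2 * sin M1 * (pi / 2 * sin D1).
  by apply: ler_pM => //; exact: le_trans D1M1.
have M1_ge : (4 * I - 3) * y <= M1.
  rewrite /M1; have : 0 <= (2 * I - 2) * (x - y) by apply: mulr_ge0; lra.
  lra.
have main : 2 * I * (M + 1) <= (4 * I - 3) * (M - 2 * I + 2).
  have : 0 <= (2 * I - 3) * (M - (8 * I - 2)) by apply: mulr_ge0; lra.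
  have : 0 <= I * (I - 2) by apply: mulr_ge0; lra.
  lra.
have h1 : (4 * I - 3) * y * D1 <= M1 * D1 by rewrite ler_wpM2r.
have h2 : y * (x - y) * (2 * I * (M + 1)) <= y * (x - y) * ((4 * I - 3) * (M - 2 * I + 2)).
  by rewrite ler_wpM2l // mulr_ge0 // ltW.
have h3 : pi * D2 * pi <= pi * D2 * 4.
  by rewrite ler_wpM2l ?mulr_ge0 ?(ltW pi0) //; lra.
have pp : 0 < pi ^+ 2 :> R by rewrite exprn_gt0.
rewrite -(ler_pM2l pp).
have h4 : y * (x - y) * (2 * I * (M + 1)) = pi * D2 by rewrite -yE /D2; ring.
have h5 : y * (x - y) * ((4 * I - 3) * (M - 2 * I + 2)) = (4 * I - 3) * y * D1.
  by rewrite D1E; ring.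
rewrite h4 h5 in h2; lra.
Qed.

(** With P = (4i-2) pi/m and Q = (4i-1) pi/(m+1) the claim amounts to
    cos Q cos (pi/(m+1)) <= cos P cos (2 pi/m). This is easy if Q is at least a
    right angle; otherwise the difference of the two sums of squared cosines is
    converted into the products of sines of [sine_products]. *)
Lemma cos2_pair_sqr m i : (0 < i)%N -> (4 * i <= m)%N ->
  cos2 R (2 * i - 1) m.+1 ^+ 2 + cos2 R (2 * i) m.+1 ^+ 2 <=
  cos2 R (2 * i - 2) m ^+ 2 + cos2 R (2 * i) m ^+ 2.
Proof.
move=> i0 im.
have m0 : (0 < m)%N by lia.
pose x : R := pi / m%:R; pose y : R := pi / m.+1%:R.
have mR : m%:R != 0 :> R by rewrite pnatr_eq0 -lt0n.
have m1R : m.+1%:R != 0 :> R by rewrite pnatr_eq0.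
have fx k : frac_pi R k m = k%:R * x by rewrite /frac_pi /x mulrA.
have fy k : frac_pi R k m.+1 = k%:R * y by rewrite /frac_pi /y mulrA.
have sqr2 (a : R) : (2 * cos a) ^+ 2 = 2 + 2 * cos (a *+ 2) by rewrite cos_mulr2n; ring.
rewrite /cos2 !fx !fy !sqr2.
have pi0 := @pi_gt0 R.
have x0 : 0 < x by rewrite divr_gt0 // ltr0n.
have y0 : 0 < y by rewrite divr_gt0 // ltr0n.
have xE : m%:R * x = pi by rewrite /x mulrC divfK.
have yE : m.+1%:R * y = pi by rewrite /y mulrC divfK.
set I : R := i%:R.
have I1 : 1 <= I by rewrite ler1n.
have i1E : (2 * i - 1)%:R = 2 * I - 1 by rewrite natrB ?natrM //; lia.
have i2E : (2 * i - 2)%:R = 2 * I - 2 by rewrite natrB ?natrM //; lia.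
have i3E : (2 * i)%:R = 2 * I by rewrite natrM.
rewrite i1E i2E i3E.
pose P := (4 * I - 2) * x; pose Q := (4 * I - 1) * y.
have sumx : cos ((2 * I - 2) * x *+ 2) + cos (2 * I * x *+ 2) = 2 * cos P * cos (2 * x).
  have -> : (2 * I - 2) * x *+ 2 = P - 2 * x by rewrite /P; ring.
  have -> : 2 * I * x *+ 2 = P + 2 * x by rewrite /P; ring.
  by rewrite cosB cosD; ring.
have sumy : cos ((2 * I - 1) * y *+ 2) + cos (2 * I * y *+ 2) = 2 * cos Q * cos y.
  have -> : (2 * I - 1) * y *+ 2 = Q - y by rewrite /Q; ring.
  have -> : 2 * I * y *+ 2 = Q + y by rewrite /Q; ring.
  by rewrite cosB cosD; ring.
suff : cos Q * cos y <= cos P * cos (2 * x) by lra.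
set M : R := m%:R in mR xE.
have m1E : m.+1%:R = M + 1 :> R by rewrite -natr1.
rewrite m1E in yE m1R.
have IM : 4 * I <= M by rewrite /I /M -natrM ler_nat.
have yx : y <= x.
  by rewrite /x /y ler_pM2l // lef_pV2 ?posrE ?ltr0n // ler_nat.
have xyE : M * (x - y) = y by lra.
have Qpi : Q <= pi.
  by rewrite -yE /Q ler_wpM2r ?(ltW y0) //; lra.
have PQ : P <= Q.
  have -> : Q = P + (M + 2 - 4 * I) * (x - y) by rewrite /P /Q; lra.
  by rewrite lerDl mulr_ge0 //; lra.
have P0 : 0 <= P by apply: mulr_ge0; lra.
have cPQ := le_cos P0 PQ Qpi.
have x2 : 2 * x <= pi / 2.
  by have : 4 * x <= M * x by [rewrite ler_wpM2r ?(ltW x0) //; lra]; rewrite xE; lra.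
have c2x : 0 <= cos (2 * x) by apply: cos_ge0_pihalf; lra.
have cyx : cos (2 * x) <= cos y.
  by apply: le_cos; [exact: ltW | lra | apply: le_trans x2 _; lra].
case: (lerP (cos Q) 0) => cQ.
  case: (lerP 0 (cos P)) => cP.
    apply: le_trans (_ : 0 <= _); last exact: mulr_ge0.
    by rewrite mulr_le0_ge0 //; lra.
  apply: le_trans (_ : cos P * cos y <= _); last by rewrite ler_wnM2l // ltW.
  by rewrite ler_wpM2r //; lra.
(* Half sums and half differences of the angles, in the order needed for the
   product formulas of cos a - cos b. *)
pose M1 := (2 * I - 1) * y + (2 * I - 2) * x.
pose D1 := (2 * I - 1) * y - (2 * I - 2) * x.
pose M2 := 2 * I * (x + y); pose D2 := 2 * I * (x - y).
suff : sin M2 * sin D2 <= sin M1 * sin D1.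
  have e1 : cos ((2 * I - 2) * x *+ 2) - cos ((2 * I - 1) * y *+ 2) = 2 * (sin M1 * sin D1).
    have -> : (2 * I - 2) * x *+ 2 = M1 - D1 by rewrite /M1 /D1; ring.
    have -> : (2 * I - 1) * y *+ 2 = M1 + D1 by rewrite /M1 /D1; ring.
    by rewrite (cosB M1 D1) (cosD M1 D1); ring.
  have e2 : cos (2 * I * y *+ 2) - cos (2 * I * x *+ 2) = 2 * (sin M2 * sin D2).
    have -> : 2 * I * y *+ 2 = M2 - D2 by rewrite /M2 /D2; ring.
    have -> : 2 * I * x *+ 2 = M2 + D2 by rewrite /M2 /D2; ring.
    by rewrite (cosB M2 D2) (cosD M2 D2); ring.
  lra.
have Q2 : Q < pi / 2.
  by rewrite ltNge; apply/negP => h; have := le_cos (_ : 0 <= pi / 2) h Qpi;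
     rewrite cos_pihalf; move: cQ => /[swap] /(_ _); lra.
have MI : 8 * I - 2 <= M.
  have lty : (8 * I - 2) * y < (M + 1) * y by rewrite yE; move: Q2; rewrite /Q; lra.
  rewrite (ltr_pM2r y0) in lty.
  have : ((8 * i)%:R < (m + 3)%:R :> R) by rewrite natrM natrD -/M -/I; lra.
  rewrite ltr_nat addn3 ltnS -addn2 -(ler_nat R) natrM natrD -/M -/I; lra.
have I12 : I = 1 \/ 2 <= I.
  by rewrite /I; case: (i) i0 => [|[|k]] // _; [left | right; rewrite ler_nat].
exact: sine_products y0 yx xE yE I12 MI.
Qed.

(** The squares B^2, C^2 lie between D^2 and A^2 and have the smaller sum. This is
    inherited by x -> (x - s)_+^2, which is a nondecreasing convex function of
    x^2 for s >= 0. *)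
Lemma pos2_pair s (A B C D : R) : 0 <= s -> B <= A -> C <= B -> D <= C -> 0 <= D ->
  B ^+ 2 + C ^+ 2 <= A ^+ 2 + D ^+ 2 ->
  pos2 (B - s) + pos2 (C - s) <= pos2 (A - s) + pos2 (D - s).
Proof.
move=> s0 BA CB DC D0 h.
case: (lerP C s) => Cs.
  rewrite (pos2_eq0 (_ : C - s <= 0)); last by lra.
  rewrite (pos2_eq0 (_ : D - s <= 0)); last by lra.
  by rewrite !addr0 pos2_mono // lerD2r.
rewrite (pos2E (_ : 0 <= A - s)); last by lra.
rewrite (pos2E (_ : 0 <= B - s)); last by lra.
rewrite (pos2E (_ : 0 <= C - s)); last by lra.
case: (lerP s D) => sD.
  rewrite (pos2E (_ : 0 <= D - s)); last by lra.
  case: (lerP (A - B) (C - D)) => AB.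
    have : 0 <= s * ((C - D) - (A - B)) by rewrite mulr_ge0 // subr_ge0.
    lra.
  have : 0 <= (A - B - (C - D)) * (A + B - 2 * s) by apply: mulr_ge0; lra.
  have : 0 <= (C - D) * (A + B - C - D) by apply: mulr_ge0; lra.
  lra.
rewrite pos2_eq0 ?addr0; last by lra.
have C0 : 0 < C by lra.
have AB0 : 0 < A + B by lra.
have e1 : 0 <= (A ^+ 2 - B ^+ 2 - (C ^+ 2 - D ^+ 2)) * (A + B - 2 * s).
  by apply: mulr_ge0; lra.
have CD : 0 <= C ^+ 2 - D ^+ 2 by have := mulr_ge0 (_ : 0 <= C - D) (_ : 0 <= C + D); lra.
have e2 : 0 <= (C ^+ 2 - D ^+ 2) * (s * (A + B - 2 * C)).
  by rewrite !mulr_ge0 //; lra.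
have e3 : 0 <= (C - s) * (s * C - D ^+ 2).
  apply: mulr_ge0; first by lra.
  have : D * D <= s * C by apply: ler_pM => //; lra.
  by rewrite expr2; lra.
rewrite -(ler_pM2l AB0) -(ler_pM2l C0).
have e3' : 0 <= (A + B) * ((C - s) * (s * C - D ^+ 2)) by rewrite mulr_ge0 // ltW.
have e1' : 0 <= C * ((A ^+ 2 - B ^+ 2 - (C ^+ 2 - D ^+ 2)) * (A + B - 2 * s)).
  by rewrite mulr_ge0 // ltW.
lra.
Qed.

(** The terms 2 i - 1 and 2 i of the path are compared with the terms 2 i - 2 and
    2 i of the cycle by [pos2_pair]; every inner term of the cycle serves two
    consecutive pairs, whence the factor 2. At most one positive term of the path
    remains, and the last term of the cycle has been used only once. *)
Lemma path_sum_le_cycle s m : 0 <= s -> (0 < m)%N ->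
  path_sum s m.+1 <=
  pos2 (2 - s) + 2 * \sum_(1 <= i < (m %/ 4).+1) pos2 (cos2 R (2 * i) m - s).
Proof.
move=> s0 m0; pose a k := pos2 (cos2 R k m - s); pose b k := pos2 (cos2 R k m.+1 - s).
have a0E : a 0%N = pos2 (2 - s) by rewrite /a /cos2 /frac_pi !mul0r cos0 mulr1.
have main K : (4 * K <= m)%N -> \sum_(1 <= k < (2 * K).+1) b k + a (2 * K)%N <=
    a 0%N + 2 * \sum_(1 <= i < K.+1) a (2 * i)%N.
  elim: K => [|K IHK] Km; first by rewrite !big_geq // muln0 add0r mulr0 addr0.
  have K4 : (4 * K <= m)%N by lia.
  have := IHK K4.
  have D0 : 0 <= cos2 R (2 * K.+1) m.
    rewrite mulr_ge0 // cos_ge0_pihalf //.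
    have -> : pi / 2 = frac_pi R 1 2 by rewrite /frac_pi mul1r.
    have := frac_pi_ge0 R 1 2; have := frac_pi_ge0 R (2 * K.+1) m.
    have -> : frac_pi R (2 * K.+1) m <= frac_pi R 1 2 by apply: frac_pi_le => //; lia.
    by lra.
  have := pos2_pair s0 _ _ _ D0 (cos2_pair_sqr (ltn0Sn K) Km).
  have -> : (2 * K.+1 - 2 = 2 * K)%N by lia.
  have -> : (2 * K.+1 - 1 = (2 * K).+1)%N by lia.
  move=> /(_ _ _ _) pair.
  have {}pair : b (2 * K).+1 + b (2 * K.+1)%N <= a (2 * K)%N + a (2 * K.+1)%N.
    by apply: pair; apply: cos2_mono; nia.
  have -> : (2 * K.+1 = (2 * K).+2)%N by lia.
  rewrite (big_nat_recr (2 * K).+2) // (big_nat_recr (2 * K).+1) //=.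
  rewrite (big_nat_recr K.+1) //=.
  have -> : (2 * K.+1 = (2 * K).+2)%N by lia.
  move: pair; have -> : (2 * K.+1 = (2 * K).+2)%N by lia.
  lra.
have [K [K1 K2]] : exists K, (m %/ 4 = K /\ 4 * K <= m < 4 * K.+1)%N.
  by exists (m %/ 4)%N; split=> //; lia.
rewrite K1; have := main K ltac:(lia).
have -> : path_sum s m.+1 = \sum_(1 <= k < m.+1) b k by [].
have last : b (2 * K).+1 <= a (2 * K)%N by rewrite pos2_mono // lerD2r cos2_mono //; nia.
have tail k : (m.+1 <= 2 * k)%N -> (k <= m.+1)%N -> b k = 0.
  move=> h1 h2; rewrite /b pos2_eq0 // subr_le0; apply: le_trans s0.
  have <- : cos2 R 1 2 = 0 by rewrite /cos2 /frac_pi mul1r cos_pihalf mulr0.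
  by apply: cos2_mono => //; lia.
have : \sum_(1 <= k < m.+1) b k <= \sum_(1 <= k < (2 * K).+1) b k + b (2 * K).+1.
  rewrite -(big_nat_recr (2 * K).+1) //=.
  case: (leqP (2 * K).+2 m.+1) => h.
    rewrite (@big_cat_nat _ _ _ (2 * K).+2 1 m.+1) //= gerDl big_nat_cond big1 //.
    by move=> k /andP[/andP[k1 k2] _]; apply: tail; lia.
  rewrite [leRHS](@big_cat_nat _ _ _ m.+1 1 (2 * K).+2) //=; last by lia.
  by rewrite lerDl sumr_ge0 // => k _; exact: pos2_ge0.
rewrite a0E; lra.
Qed.

End CycleVsPath.

(** * The spectrum of a path *)

(** As many distinct eigenvalues as the dimension exhaust the spectrum. *)
Lemma sum_distinct_eigenvalues (R : rcfType) n (A : 'M[R]_n) (f : 'I_n -> R) (F : R -> R) :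
  A^T = A -> injective f -> (forall i, eigenvalue A (f i)) ->
  \sum_(x <- eigenvalues A) F x = \sum_i F (f i).
Proof.
move=> symA f_inj eig_f; have charA := symmetric_eigenvalues symA.
have -> : \sum_i F (f i) = \sum_(x <- [seq f i | i : 'I_n]) F x by rewrite big_map big_enum.
have uf : uniq [seq f i | i : 'I_n] by rewrite map_inj_uniq ?enum_uniq.
have sub : {subset [seq f i | i : 'I_n] <= eigenvalues A}.
  move=> _ /mapP[i _ ->]; have := eig_f i.
  by rewrite eigenvalue_root_char charA root_prod_XsubC.
have sz : size (eigenvalues A) = n.
  by have := size_char_poly A; rewrite charA size_prod_XsubC => -[].
have szf : (size (eigenvalues A) <= size [seq f i | i : 'I_n])%N.
  by rewrite size_map size_enum_ord sz.
have [_ eqm] := uniq_min_size uf sub szf.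
by apply: perm_big; rewrite perm_sym uniq_perm // (leq_size_uniq uf).
Qed.

Section PathSpectrum.
Variable R : realType.

Lemma sum_ord_pick n a (g : nat -> R) :
  \sum_(i < n) (i == a :> nat)%:R * g i = (a < n)%N%:R * g a.
Proof.
case: (ltnP a n) => an; last first.
  rewrite mul0r big1 // => i _; case: eqP => [e|_]; last by rewrite mul0r.
  by have := ltn_ord i; rewrite e ltnNge an.
rewrite (bigD1 (Ordinal an)) //= eqxx big1 ?addr0 // => i ia.
by rewrite (_ : (i == a :> nat) = false) ?mul0r //; apply/negbTE.
Qed.

Lemma sum_path_adj n (k : 'I_n) (g : nat -> R) :
  \sum_(i < n) (path_adj i k)%:R * g i =
  (0 < k)%N%:R * g k.-1 + (k.+1 < n)%N%:R * g k.+1.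
Proof.
have E (i : 'I_n) : (path_adj i k)%:R * g i =
    (0 < k)%N%:R * ((i == k.-1 :> nat)%:R * g i) + (i == k.+1 :> nat)%:R * g i.
  rewrite /path_adj eq_sym [_ == i :> nat]eq_sym.
  case: (eqVneq (i : nat) k.+1) => [->|ne].
    have -> : (k == k.+2 :> nat) = false by apply/negbTE; lia.
    have -> : (k.+1 == k.-1 :> nat) = false by apply/negbTE; lia.
    by rewrite /= mul0r mulr0 add0r.
  rewrite orbF mul0r addr0 mulrA -natrM mulnb.
  by congr (_%:R * _); congr nat_of_bool; lia.
under eq_bigr do rewrite E.
rewrite big_split /= -mulr_sumr !sum_ord_pick mulrA -natrM mulnb.
congr (_%:R * _ + _); congr nat_of_bool; have := ltn_ord k; lia.
Qed.

Lemma signless_laplacian_row (G : sgraph) (w : G -> R) (y : 'I_#|G|) :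
  ((\row_i w (enum_val i)) *m signless_laplacian R G) 0 y =
  \sum_(x : G) (adj x (enum_val y))%:R * (w x + w (enum_val y)).
Proof.
rewrite mulmxDr mxE; under [RHS]eq_bigr do rewrite mulrDr.
rewrite big_split /= addrC; congr (_ + _).
  rewrite mxE (reindex _ (onW_bij _ (enum_val_bij G))) /=.
  by apply: eq_bigr => i _; rewrite !mxE mulrC.
rewrite /deg_mx mul_mx_diag !mxE mulrC -mulr_suml; congr (_ * _).
rewrite /degree cardsE -sum1_card natr_sum big_mkcond /=.
apply: eq_bigr => x _; rewrite -[x \in _]/(adj (enum_val y) x) adj_sym.
by case: (adj _ _).
Qed.

(** The eigenvector is (-1)^x cos ((x + 1/2) j pi / n): the sign turns the signless
    Laplacian into the Laplacian, and the half-integer phase gives the reflecting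
    boundary conditions d 0 = d 1 and d n = d n.+1. *)
Lemma path_eigenvalue n j : (j < n)%N ->
  eigenvalue (signless_laplacian R (path_graph n)) (2 - cos2 R j n).
Proof.
move=> jn; have n0 : (0 < n)%N by lia.
pose al := frac_pi R j n.
have nal : n%:R * al = j%:R * pi by rewrite /al /frac_pi mulrC divfK // pnatr_eq0 -lt0n.
pose d k : R := cos (k%:R * al - al / 2).
pose w (x : path_graph n) : R := (-1) ^+ x * d x.+1.
have d01 : d 0%N = d 1%N.
  by rewrite /d mul0r sub0r cosN mul1r; congr cos; field.
have dn : d n.+1 = d n.
  rewrite /d -natr1 mulrDl nal mul1r.
  have -> : j%:R * pi + al - al / 2 = al / 2 + pi *+ j by rewrite -mulr_natl; field.
  have -> : j%:R * pi - al / 2 = - (al / 2) + pi *+ j by rewrite -mulr_natl; field.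
  by rewrite !(alternatingn (@cosDpi R)) cosN.
have dn' k : k.+1 = n -> d k.+2 = d k.+1 by move=> kn; rewrite kn.
have drec k : d k + d k.+2 = cos2 R j n * d k.+1.
  rewrite /d /cos2 -/al.
  have -> : k%:R * al - al / 2 = (k.+1%:R * al - al / 2) - al by rewrite -natr1; ring.
  have -> : k.+2%:R * al - al / 2 = (k.+1%:R * al - al / 2) + al by rewrite -natr1; ring.
  by set z := _ - al / 2; rewrite (cosB z al) (cosD z al); ring.
apply/eigenvalueP; exists (\row_i w (enum_val i)).
  apply/rowP => y; rewrite signless_laplacian_row !mxE.
  set k : 'I_n := enum_val y.
  pose g i : R := (-1) ^+ i * d i.+1 + (-1) ^+ k * d k.+1.
  transitivity (\sum_(i < n) (path_adj i k)%:R * g i) => //.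
  rewrite sum_path_adj /g.
  have left : (0 < k)%N%:R * ((-1) ^+ k.-1 * d k.-1.+1 + (-1) ^+ k * d k.+1)
      = (-1) ^+ k * (d k.+1 - d k).
    case: (k : nat) => [|k']; first by rewrite mul0r d01 subrr mulr0.
    by rewrite /= exprS; ring.
  have right : (k.+1 < n)%N%:R * ((-1) ^+ k.+1 * d k.+2 + (-1) ^+ k * d k.+1)
      = (-1) ^+ k * (d k.+1 - d k.+2).
    have := ltn_ord k; rewrite leq_eqVlt => /orP[/eqP kn|kn].
      have -> : (k.+1 < n)%N = false by lia.
      by rewrite mul0r (dn' _ kn) subrr mulr0.
    by rewrite kn mul1r exprS; ring.
  rewrite left right -mulrDr.
  have -> : d k.+1 - d k + (d k.+1 - d k.+2) = 2 * d k.+1 - (d k + d k.+2) by ring.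
  by rewrite drec /w -/k; ring.
apply/eqP => /rowP /(_ (enum_rank (Ordinal n0 : path_graph n))).
rewrite !mxE enum_rankK /w /= expr0 mul1r /d mul1r => /eqP; apply/negP.
rewrite gt_eqF // cos_gt0_pihalf //.
have -> : al - al / 2 = al / 2 by field.
have := @pi_gt0 R.
have := frac_pi_ge0 R j n; have : al < pi.
  rewrite /al /frac_pi ltr_pdivrMr ?ltr0n // mulrC ltr_pM2l ?pi_gt0 //.
  by rewrite ltr_nat.
rewrite -/al; lra.
Qed.

(** The eigenvalue at j = 0 is 0 and contributes nothing; for the others j -> n - j
    changes the sign of the cosine. *)
Lemma Psi_path (t : R) m : 2 <= t -> Psi t (path_graph m.+1) = path_sum (t - 2) m.+1.
Proof.
move=> t2; rewrite /Psi.
pose f (i : 'I_#|path_graph m.+1|) : R := 2 - cos2 R i m.+1.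
have cardn : #|path_graph m.+1| = m.+1 by rewrite card_ord.
have ltk (k : 'I_#|path_graph m.+1|) : (k < m.+1)%N.
  by apply: leq_trans (ltn_ord k) _; rewrite cardn.
have f_inj : injective f.
  move=> i i'; rewrite /f => /addrI /oppr_inj /cos2_inj E.
  by apply: val_inj; apply: E; rewrite // ltnW.
rewrite (sum_distinct_eigenvalues _ (signless_laplacian_sym R _) f_inj); last first.
  by move=> i; apply: path_eigenvalue.
rewrite -(big_mkord predT (fun i => Num.max (2 - cos2 R i m.+1 - t) 0 ^+ 2)) cardn.
have E i : Num.max (2 - cos2 R i m.+1 - t) 0 ^+ 2 = pos2 (- cos2 R i m.+1 - (t - 2)).
  by rewrite /pos2; congr (Num.max _ _ ^+ 2); ring.
under eq_bigr do rewrite E.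
rewrite big_ltn // /path_sum /fsum (sum_half (fun x => pos2 (x - (t - 2)))) //.
rewrite pos2_eq0 ?add0r // /cos2 /frac_pi !mul0r cos0; lra.
Qed.
End PathSpectrum.

(** * Gram matrices of edge sets *)

Section EdgeGram.
Variables (R : rcfType) (V : finType) (N : nat) (ends : 'I_N -> {set V}).
Hypothesis ends2 : forall e, #|ends e| = 2.
Hypothesis ends_inj : injective ends.
Implicit Types (S T B C : {set 'I_N}) (e f : 'I_N) (z : V).

(** All sets of edges share the index type 'I_N; entries outside S are zero. Adding
    zero eigenvalues does not change [psi t] for t >= 0. *)
Definition gram S : 'M[R]_N :=
  \matrix_(e, f) if (e \in S) && (f \in S) then #|ends e :&: ends f|%:R else 0.

Lemma gram_sym S : (gram S)^T = gram S.
Proof. by apply/matrixP => e f; rewrite !mxE andbC setIC. Qed.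

Lemma gram_ge0 S e f : 0 <= gram S e f.
Proof. by rewrite mxE; case: ifP. Qed.

Lemma gram_ge1 S e f z : e \in S -> f \in S -> z \in ends e -> z \in ends f ->
  1 <= gram S e f.
Proof.
move=> eS fS ze zf; rewrite mxE eS fS ler1n card_gt0; apply/set0Pn; exists z.
by rewrite inE ze.
Qed.

Lemma gram_diag S e : e \in S -> gram S e e = 2.
Proof. by move=> eS; rewrite mxE eS setIid ends2. Qed.

Lemma meet_le1 e f : e != f -> (#|ends e :&: ends f| <= 1)%N.
Proof.
apply: contraNT; rewrite -ltnNge => c2; apply/eqP/ends_inj.
have /eqP -> : ends e == ends e :&: ends f.
  by rewrite eq_sym eqEcard subsetIl ends2.
by apply/eqP; rewrite eqEcard subsetIr ends2.
Qed.

Lemma gram_sub S B e f : B \subset S -> e \in B -> f \in B -> gram S e f = gram B e f.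
Proof. by move=> /subsetP BS eB fB; rewrite !mxE eB fB !BS. Qed.

Definition star B z : {set 'I_N} := [set e in B | z \in ends e].

Definition indic B : 'cV[R]_N := \col_e (e \in B)%:R.

Lemma qform1_indic B : qform 1%:M (indic B) = #|B|%:R.
Proof.
rewrite qform1E -sum1_card natr_sum [RHS]big_mkcond; apply: eq_bigr => e _.
by rewrite mxE; case: (e \in B); rewrite ?expr1n // expr0n.
Qed.

(** The entry at e, f counts the vertices common to e and f. *)
Lemma qform_gram S (v : 'cV[R]_N) :
  qform (gram S) v = \sum_z ((indic (star S z))^T *m v) 0 0 ^+ 2.
Proof.
rewrite qformE.
have sE z : ((indic (star S z))^T *m v) 0 0 ^+ 2 =
    \sum_e \sum_f ((e \in star S z) && (f \in star S z))%:R * (v e 0 * v f 0).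
  rewrite mxE expr2 mulr_suml; apply: eq_bigr => e _.
  rewrite mulr_sumr; apply: eq_bigr => f _; rewrite !mxE -mulnb natrM; ring.
under [RHS]eq_bigr do rewrite sE.
rewrite [RHS]exchange_big /=; apply: eq_bigr => e _.
rewrite [RHS]exchange_big /=; apply: eq_bigr => f _.
rewrite -mulr_suml mulrAC mulrC; congr (_ * _).
rewrite mxE -natr_sum; case: ifP => ef; last first.
  by rewrite big1 // => z _; rewrite !inE andbACA ef.
congr (_%:R); rewrite -sum1_card big_mkcond /=; apply: eq_bigr => z _.
by rewrite !inE andbACA ef /=; case: (_ && _).
Qed.

Lemma gram_star_le S z (v : 'cV[R]_N) :
  ((indic (star S z))^T *m v) 0 0 ^+ 2 <= qform (gram S) v.
Proof.
rewrite qform_gram (bigD1 z) //= lerDl sumr_ge0 // => y _; exact: sqr_ge0.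
Qed.

(** The optimal trial matrices of disjoint edge sets therefore have disjoint
    supports. *)
Lemma positive_part_gram_out (t : R) B (Z : 'M[R]_N) e f : 0 < t ->
  positive_part t (gram B) Z -> (e \notin B) || (f \notin B) -> Z e f = 0.
Proof.
move=> t0 ppZ; have symZ := (pp_psd ppZ).1.
have out g h : h \notin B -> Z g h = 0.
  move=> hB; apply: (positive_part_support t0 ppZ) => i.
  by rewrite mxE (negPf hB) andbF.
by case/orP => [eB|]; [rewrite -symZ mxE|]; exact: out.
Qed.

Lemma trace_block (t : R) S B (Z : 'M[R]_N) : 0 < t -> B \subset S ->
  positive_part t (gram B) Z -> \tr ((gram S - t%:M) *m Z) = \tr (Z *m Z).
Proof.
move=> t0 BS ppZ; rewrite -(pp_mul ppZ) [RHS]mxtrace_mulC.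
apply: eq_bigr => e _; rewrite !mxE; apply: eq_bigr => f _; rewrite !mxE.
have [/andP[fB eB]|out] := boolP ((f \in B) && (e \in B)).
  by rewrite eB fB (subsetP BS _ eB) (subsetP BS _ fB).
by rewrite (positive_part_gram_out t0 ppZ) ?mulr0 //; move: out; rewrite negb_and.
Qed.

End EdgeGram.

(** * The gain from a claw *)

Section BilinearForms.
Variable R : rcfType.

Definition bform n (A : 'M[R]_n) (u v : 'cV[R]_n) : R := (u^T *m A *m v) 0 0.

Lemma bformE n (A : 'M[R]_n) u v : bform A u v = \sum_i \sum_j u i 0 * A i j * v j 0.
Proof.
rewrite /bform mxE exchange_big; apply: eq_bigr => j _.
by rewrite mxE mulr_suml; apply: eq_bigr => i _; rewrite mxE.
Qed.

Lemma bformDl n (A : 'M[R]_n) u u' v : bform A (u + u') v = bform A u v + bform A u' v.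
Proof. by rewrite /bform linearD /= !mulmxDl mxE. Qed.

Lemma bformDr n (A : 'M[R]_n) u v v' : bform A u (v + v') = bform A u v + bform A u v'.
Proof. by rewrite /bform mulmxDr mxE. Qed.

Lemma bformZl n (A : 'M[R]_n) b u v : bform A (b *: u) v = b * bform A u v.
Proof. by rewrite /bform linearZ /= -!scalemxAl mxE. Qed.

Lemma bformZr n (A : 'M[R]_n) b u v : bform A u (b *: v) = b * bform A u v.
Proof. by rewrite /bform -scalemxAr mxE. Qed.

Lemma bformC n (A : 'M[R]_n) u v : A^T = A -> bform A u v = bform A v u.
Proof.
move=> symA; rewrite !bformE exchange_big; apply: eq_bigr => i _; apply: eq_bigr => j _.
by rewrite -{1}symA mxE; ring.
Qed.

Lemma bform_sumr n (A : 'M[R]_n) u (I : finType) (P : pred I) (v : I -> 'cV[R]_n) :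
  bform A u (\sum_(i | P i) v i) = \sum_(i | P i) bform A u (v i).
Proof. by rewrite /bform mulmx_sumr summxE. Qed.

Lemma bform_suml n (A : 'M[R]_n) u (I : finType) (P : pred I) (v : I -> 'cV[R]_n) :
  bform A (\sum_(i | P i) v i) u = \sum_(i | P i) bform A (v i) u.
Proof. by rewrite /bform linear_sum /= !mulmx_suml summxE. Qed.

Lemma qform_add n (A : 'M[R]_n) u v (b : R) : A^T = A ->
  qform A (u + b *: v) = qform A u + 2 * b * bform A u v + b ^+ 2 * qform A v.
Proof.
move=> symA; rewrite -![qform _ _]/(bform _ _ _) bformDl !bformDr !bformZl !bformZr.
by rewrite (bformC v u symA); ring.
Qed.
End BilinearForms.

Section ClawGain.
Variables (R : rcfType) (V : finType) (N : nat) (ends : 'I_N -> {set V}).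
Hypothesis ends2 : forall e, #|ends e| = 2.
Hypothesis ends_inj : injective ends.
Implicit Types (S T B C : {set 'I_N}) (e f : 'I_N) (z : V).
Local Notation gram := (gram R ends).
Local Notation indic := (indic R).

Lemma indicE B e : indic B e 0 = (e \in B)%:R. Proof. by rewrite mxE. Qed.

Lemma bform_ge0 S (u v : 'cV[R]_N) : (forall e, 0 <= u e 0) -> (forall e, 0 <= v e 0) ->
  0 <= bform (gram S) u v.
Proof.
move=> u0 v0; rewrite bformE sumr_ge0 // => e _; rewrite sumr_ge0 // => f _.
by rewrite !mulr_ge0 // gram_ge0.
Qed.

(** The Gram matrix of three edges with a common end has diagonal 2 and entries at
    least 1 elsewhere: 3 * 2 + 6 * 1. *)
Lemma qform_gram_claw S C v : C \subset S -> #|C| = 3 -> (forall e, e \in C -> v \in ends e) ->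
  12 <= qform (gram S) (indic C).
Proof.
move=> CS C3 Cv; rewrite qformE.
have -> : 12 = \sum_(e in C) \sum_(f in C) (1 + (f == e)%:R) :> R.
  have inner e : e \in C -> \sum_(f in C) (1 + (f == e)%:R) = 4 :> R.
    move=> eC; rewrite big_split /= sumr_const C3 (bigD1 e) //= eqxx big1 ?addr0 -?natrD //.
    by move=> f /andP[_ /negPf ->].
  by rewrite (eq_bigr _ inner) sumr_const C3 -mulrnA.
rewrite [leRHS](bigID (fun e => e \in C)) /= [X in _ + X]big1 ?addr0; last first.
  by move=> e /negPf eC; rewrite big1 // => f _; rewrite indicE eC !mul0r.
apply: ler_sum => e eC.
rewrite [leRHS](bigID (fun e => e \in C)) /= [X in _ + X]big1 ?addr0; last first.
  by move=> f /negPf fC; rewrite !indicE fC mulr0.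
apply: ler_sum => f fC; rewrite !indicE eC fC mul1r mulr1.
case: eqVneq => [->|fe]; first by rewrite gram_diag ?(subsetP CS) //; lra.
by rewrite addr0 (gram_ge1 _ (z := v)) ?Cv ?(subsetP CS).
Qed.

Lemma qform_local B (Z : 'M[R]_N) (u v : 'cV[R]_N) :
  (forall e f, (e \notin B) || (f \notin B) -> Z e f = 0) ->
  (forall e, e \in B -> u e 0 = v e 0) -> qform Z u = qform Z v.
Proof.
move=> Zout uv; rewrite !qformE; apply: eq_bigr => e _; apply: eq_bigr => f _.
have [/andP[eB fB]|out] := boolP ((e \in B) && (f \in B)).
  by rewrite !uv.
by rewrite Zout -?negb_and // !mulr0 !mul0r.
Qed.

Lemma qform_gram_local S B (v : 'cV[R]_N) : B \subset S ->
  (forall e, e \notin B -> v e 0 = 0) -> qform (gram S) v = qform (gram B) v.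
Proof.
move=> BS vout; rewrite !qformE; apply: eq_bigr => e _; apply: eq_bigr => f _.
have [eB|eB] := boolP (e \in B); last by rewrite vout // !mul0r.
have [fB|fB] := boolP (f \in B); last by rewrite (vout f) // !mulr0.
by rewrite (gram_sub R ends BS eB fB).
Qed.

Lemma bform1_disjoint (u v : 'cV[R]_N) : (forall e, u e 0 * v e 0 = 0) ->
  bform 1%:M u v = 0.
Proof.
move=> uv; rewrite /bform mulmx1 mxE big1 // => e _; by rewrite mxE uv.
Qed.

(** Gain from a claw C of S, relative to the pieces P of S minus C: the trial
    matrix is the sum of the optimal ones of the pieces plus a rank-one matrix
    along 1_C + b y, where y averages the edges of each joined piece at its
    port. *)
Lemma psi_claw (t : R) S C v (P J : {set {set 'I_N}}) (port : {set 'I_N} -> V)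
    (kap b lam : R) :
  2 <= t -> C \subset S -> #|C| = 3 -> (forall e, e \in C -> v \in ends e) ->
  partition P (S :\: C) -> J \subset P ->
  (forall B, B \in J -> star ends B (port B) != set0) ->
  (forall B f, B \in J -> f \in star ends B (port B) ->
     kap <= \sum_(e in C) gram S e f) ->
  0 <= b -> 0 <= lam -> t - 2 <= lam ->
  lam * (3 + b ^+ 2 * #|J|%:R) <= 6 + 2 * b * kap * #|J|%:R - b ^+ 2 * #|J|%:R ->
  \sum_(B in P) psi t (gram B) + (lam - (t - 2)) ^+ 2 <= psi t (gram S).
Proof.
move=> t2 CS C3 Cv partP /subsetP JP starJ kapJ b0 lam0 lamt lamJ.
have t0 : 0 < t by lra.
have [Z0 Z0P] := fin_all_exists (fun B => positive_part_exists t (gram_sym R ends B)).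
pose Z B := if B \in P then Z0 B else 0.
have /and3P[/eqP coverP trivP _] := partP.
have PR B : B \in P -> B \subset S :\: C.
  by move=> BP; rewrite -coverP; exact: bigcup_sup.
have PS B : B \in P -> B \subset S.
  by move=> BP; apply: subset_trans (PR B BP) (subsetDl _ _).
have PC B e : B \in P -> e \in B -> (e \in C) = false.
  by move=> BP eB; have := subsetP (PR B BP) e eB; rewrite inE => /andP[/negPf].
have Pdisj B B' e : B \in P -> B' \in P -> B != B' -> e \in B -> e \in B' = false.
  move=> BP BP' BB' eB; apply/negbTE; apply: contra BB' => eB'.
  by rewrite -(def_pblock trivP BP eB) (def_pblock trivP BP' eB').
have Zout B e f : (e \notin B) || (f \notin B) -> Z B e f = 0.
  rewrite /Z; case: ifP => BP; last by rewrite mxE.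
  exact: positive_part_gram_out (Z0P B).
pose r B : R := #|star ends B (port B)|%:R.
pose y B : 'cV[R]_N := (r B)^-1 *: indic (star ends B (port B)).
have r1 B : B \in J -> 1 <= r B by move=> BJ; rewrite ler1n card_gt0 starJ.
have r0 B : B \in J -> r B != 0 by move=> BJ; rewrite gt_eqF // (lt_le_trans _ (r1 B BJ)).
have yE B e : y B e 0 = (r B)^-1 * (e \in star ends B (port B))%:R by rewrite !mxE.
have y_ge0 B e : 0 <= y B e 0 by rewrite yE mulr_ge0 // invr_ge0.
have yout B e : e \notin B -> y B e 0 = 0.
  by move=> eB; rewrite yE inE (negPf eB) mulr0.
pose Y := \sum_(B in J) y B; pose w := indic C + b *: Y.
pose rho := \sum_(B in J) (r B)^-1; pose q : R := #|J|%:R.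
have rho_q : rho <= q.
  rewrite /q -sum1_card natr_sum; apply: ler_sum => B BJ.
  by rewrite invf_le1 ?r1 // (lt_le_trans _ (r1 B BJ)).
have rho0 : 0 <= rho by rewrite sumr_ge0 // => B _; rewrite invr_ge0.
have symG := gram_sym R ends S.
have Y_on B e : B \in P -> e \in B -> Y e 0 = if B \in J then y B e 0 else 0.
  move=> BP eB; rewrite /Y summxE; case: ifP => BJ.
    rewrite (bigD1 B) //= big1 ?addr0 // => B' /andP[BJ' BB'].
    by rewrite yout // (Pdisj _ _ _ BP (JP _ BJ') _ eB) // eq_sym.
  rewrite big1 // => B' BJ'; rewrite yout // (Pdisj _ _ _ BP (JP _ BJ') _ eB) //.
  by apply: contraFneq BJ => ->.
have Y_C e : e \in C -> Y e 0 = 0.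
  move=> eC; rewrite /Y summxE big1 // => B BJ; rewrite yout //.
  by apply/negP => /(PC _ _ (JP _ BJ)); rewrite eC.
have q1y B : B \in J -> qform 1%:M (y B) = (r B)^-1.
  move=> BJ; rewrite -[qform _ _]/(bform _ _ _) bformZl bformZr.
  by rewrite [bform _ _ _]qform1_indic -/(r B); field; exact: r0.
have N_E : qform 1%:M w = 3 + b ^+ 2 * rho.
  rewrite /w qform_add ?trmx1 // qform1_indic C3.
  rewrite bform1_disjoint ?mulr0 ?addr0; last first.
    move=> e; rewrite indicE; case: (boolP (e \in C)) => eC; rewrite ?mul0r //.
    by rewrite Y_C ?mulr0.
  congr (_ + _ * _); rewrite -[qform _ _]/(bform _ _ _) {2}/Y bform_sumr /rho.
  apply: eq_bigr => B BJ; rewrite -(q1y B BJ) /Y bform_suml (bigD1 B) //=.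
  rewrite big1 ?addr0 // => B' /andP[BJ' BB'].
  apply: bform1_disjoint => e; have [eB|eB] := boolP (e \in B); last by rewrite (yout B) ?mulr0.
  by rewrite (yout B') ?mul0r // (Pdisj _ _ _ (JP _ BJ) (JP _ BJ') _ eB) // eq_sym.
have main : (lam - (t - 2)) * qform 1%:M w <= qform (gram S - t%:M) w - \sum_B qform (Z B) w.
  have zE : \sum_B qform (Z B) w = b ^+ 2 * \sum_(B in J) qform (Z0 B) (y B).
    rewrite mulr_sumr [RHS]big_mkcond; apply: eq_bigr => B _.
    have [BP|BP] := boolP (B \in P); last first.
      rewrite /Z (negPf BP); case: ifP => [/JP|_]; first by rewrite (negPf BP).
      by rewrite /qform mulmx0 mul0mx mxE.
    rewrite (qform_local (v := b *: (if B \in J then y B else 0)) (Zout B)); last first.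
      move=> e eB; rewrite !mxE (PC B) // add0r (Y_on B) //.
      by case: ifP; rewrite ?mxE.
    have qz (x : 'cV[R]_N) : qform (Z B) (b *: x) = b ^+ 2 * qform (Z B) x.
      by rewrite -![qform _ _]/(bform _ _ _) bformZl bformZr mulrA.
    rewrite qz /Z BP; case: ifP => // _.
    by rewrite /qform mulmx0 mxE mulr0.
  have gY : \sum_(B in J) qform (gram B) (y B) <= qform (gram S) Y.
    rewrite -[leRHS]/(bform _ _ _) {2}/Y bform_sumr; apply: ler_sum => B BJ.
    rewrite -(qform_gram_local (PS _ (JP _ BJ)) (yout B)) /Y bform_suml (bigD1 B) //=.
    by rewrite lerDl sumr_ge0 // => B' _; exact: bform_ge0.
  have kY : kap * q <= bform (gram S) (indic C) Y.
    rewrite /Y bform_sumr /q -sum1_card natr_sum mulr_sumr; apply: ler_sum => B BJ.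
    rewrite mulr1 bformZr bformE exchange_big /=.
    rewrite (_ : \sum_j _ = \sum_(f in star ends B (port B)) \sum_(e in C) gram S e f).
      rewrite ler_pdivlMl ?(lt_le_trans _ (r1 B BJ)) //.
      rewrite mulrC mulr_natr -sumr_const; apply: ler_sum => f; exact: kapJ.
    rewrite [RHS]big_mkcond; apply: eq_bigr => f _; rewrite -mulr_suml indicE.
    case: ifP => _; rewrite ?mulr0 // mulr1 [RHS]big_mkcond.
    by apply: eq_bigr => e _; rewrite indicE; case: ifP; rewrite ?mul1r ?mul0r.
  have cost : \sum_(B in J) qform (Z0 B) (y B) -
      \sum_(B in J) qform (gram B) (y B) + t * rho <= (t - 1) * rho.
    rewrite /rho !mulr_sumr -sumrB -big_split /=; apply: ler_sum => B BJ.
    have := negative_part_le (gram_sym R ends B) t2 (Z0P B) (@gram_star_le R V N ends B (port B)) _.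
    rewrite qform1_indic -/(r B) => /(_ (r1 B BJ)).
    rewrite qformD qformN qform_scalar qform1_indic -/(r B) => h.
    have qz (A : 'M[R]_N) : qform A (y B) = (r B)^-2 * qform A (indic (star ends B (port B))).
      by rewrite -![qform _ _]/(bform _ _ _) bformZl bformZr mulrA; field; exact: r0.
    rewrite !qz -(ler_pM2l (_ : 0 < r B ^+ 2)); last first.
      by rewrite exprn_gt0 // (lt_le_trans _ (r1 B BJ)).
    set u := qform (Z0 B) _ in h *; set u' := qform (gram B) _ in h *.
    have -> : r B ^+ 2 * ((r B)^-2 * u - (r B)^-2 * u' + t * (r B)^-1) = u - u' + t * r B.
      by field; exact: r0.
    have -> : r B ^+ 2 * ((t - 1) * (r B)^-1) = r B * (t - 1) by field; exact: r0.
    lra.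
  rewrite zE N_E qformD qformN qform_scalar N_E /w qform_add //.
  have g12 := qform_gram_claw CS C3 Cv.
  set G := \sum_(B in J) qform (gram B) _ in gY cost.
  set K := \sum_(B in J) qform (Z0 B) _ in cost *.
  have b2 : 0 <= b ^+ 2 by rewrite sqr_ge0.
  have := ler_wpM2l b2 gY; have := ler_wpM2l b2 cost.
  have := ler_wpM2l (mulr_ge0 (ler0n R 2) b0) kY.
  have : 0 <= b ^+ 2 * (1 + lam) * (q - rho) by rewrite !mulr_ge0 ?subr_ge0 //; lra.
  rewrite -/q in lamJ; lra.
have -> : \sum_(B in P) psi t (gram B) = \sum_B \tr (Z B *m Z B).
  rewrite [LHS]big_mkcond; apply: eq_bigr => B _; rewrite /Z.
  by case: ifP => _; rewrite ?mulmx0 ?mxtrace0 // (pp_tr (Z0P B)).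
apply: (psi_ge_blocks symG _ _ _ _ main).
- move=> B; rewrite /Z; case: ifP => _; first exact: pp_psd (Z0P B).
  by split=> [|x]; rewrite ?trmx0 // /qform mulmx0 mul0mx mxE.
- move=> B B' BB'; apply/matrixP => e g; rewrite !mxE big1 // => f _.
  have [BP|BP] := boolP (B \in P); last by rewrite /Z (negPf BP) mxE mul0r.
  have [BP'|BP'] := boolP (B' \in P); last by rewrite [Z B']/Z (negPf BP') mxE mulr0.
  have [fB|fB] := boolP (f \in B); last by rewrite Zout ?mul0r // fB orbT.
  by rewrite (Zout B') ?mulr0 // (Pdisj B B').
- move=> B; rewrite /Z; case: ifP => BP; last by rewrite !mulmx0.
  exact: trace_block (PS B BP) (Z0P B).
- by rewrite subr_ge0.
have := mulr_ge0 (sqr_ge0 b) rho0; rewrite N_E; lra.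
Qed.
End ClawGain.

(** * Connected edge sets and their pieces *)

Section LineConnectivity.
Variables (V : finType) (N : nat) (ends : 'I_N -> {set V}).
Implicit Types (S T B C : {set 'I_N}) (e f g : 'I_N) (z : V).

Definition edges_meet e f := ends e :&: ends f != set0.

Local Notation meet := edges_meet.

Lemma meetP e f : reflect (exists2 z, z \in ends e & z \in ends f) (meet e f).
Proof.
rewrite /edges_meet; apply: (iffP (set0Pn _)) => [[z]|[z ze zf]]; first by rewrite inE => /andP[]; exists z.
by exists z; rewrite inE ze.
Qed.

Lemma meet_sym e f : meet e f = meet f e. Proof. by rewrite /edges_meet setIC. Qed.

Definition line_rel S : rel 'I_N := fun e f => [&& e \in S, f \in S & meet e f].

Lemma line_rel_sym S : symmetric (line_rel S).
Proof. by move=> e f; rewrite /line_rel meet_sym andbCA. Qed.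

(** Connectedness of the subgraph formed by the edges in S, expressed through
    chains of meeting edges. *)
Definition line_connected S :=
  forall e f, e \in S -> f \in S -> connect (line_rel S) e f.

Lemma connect_within S B e f :
  (forall g h, g \in B -> line_rel S g h -> h \in B) ->
  e \in B -> connect (line_rel S) e f -> connect (line_rel B) e f /\ f \in B.
Proof.
move=> closedB + /connectP [p]; elim: p e => [|g p IHp] e eB /=; first by move=> _ ->.
case/andP=> eg pgp lastp; have gB := closedB _ _ eB eg.
have [gf fB] := IHp g gB pgp lastp; split=> //; apply: connect_trans gf.
by apply: connect1; rewrite /line_rel eB gB; case/and3P: eg.
Qed.

Definition pieces S := equivalence_partition (connect (line_rel S)) S.

Lemma connect_line_equiv S : {in S & &, equivalence_rel (connect (line_rel S))}.
Proof.
move=> e f g _ _ _; split=> // ef; apply/idP/idP; last exact: connect_trans.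
by apply: connect_trans; rewrite (sym_connect_sym (@line_rel_sym S)).
Qed.

Lemma pieces_partition S : partition (pieces S) S.
Proof. exact: equivalence_partitionP (@connect_line_equiv S). Qed.

Lemma pieces_sub S B : B \in pieces S -> B \subset S.
Proof.
by move=> BP; rewrite -(cover_partition (pieces_partition S)); exact: bigcup_sup.
Qed.

Lemma piece_closed S B e f :
  B \in pieces S -> e \in B -> f \in S -> meet e f -> f \in B.
Proof.
move=> BP eB fS ef; have eS := subsetP (pieces_sub BP) e eB.
have /and3P[_ trivP _] := pieces_partition S.
rewrite -(def_pblock trivP BP eB).
rewrite (pblock_equivalence_partition (@connect_line_equiv S)) //.
by apply: connect1; rewrite /line_rel eS fS.
Qed.

Lemma piece_connected S B : B \in pieces S -> line_connected B.
Proof.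
move=> BP e f eB fB; have BS := subsetP (pieces_sub BP).
have /and3P[_ trivP _] := pieces_partition S.
have cef : connect (line_rel S) e f.
  rewrite -(pblock_equivalence_partition (@connect_line_equiv S)) ?BS //.
  by rewrite (def_pblock trivP BP eB).
apply: (proj1 (connect_within _ eB cef)) => g h gB /and3P[_ hS gh].
exact: piece_closed gB hS gh.
Qed.

Lemma piece_neq0 S B : B \in pieces S -> B != set0.
Proof.
move=> BP; apply: contraTneq BP => ->.
by have /and3P[] := pieces_partition S.
Qed.

(** Otherwise the piece B would be closed in S and miss e0. *)
Lemma piece_meets S C B e0 : line_connected S -> C \subset S -> e0 \in C ->
  B \in pieces (S :\: C) -> exists f e, [/\ f \in B, e \in C & meet f e].
Proof.
move=> connS CS e0C BP.
have [/existsP[f /existsP[e /and3P[]]]|none] :=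
  boolP [exists f, exists e, [&& f \in B, e \in C & meet f e]]; first by exists f, e.
have /set0Pn[g gB] := piece_neq0 BP.
have gR := subsetP (pieces_sub BP) g gB.
have ge0 : connect (line_rel S) g e0.
  by apply: connS; [move: gR; rewrite inE => /andP[] | exact: subsetP e0C].
have closedB h k : h \in B -> line_rel S h k -> k \in B.
  move=> hB /and3P[_ kS hk]; have [kC|kC] := boolP (k \in C).
    case/negP: none; apply/existsP; exists h; apply/existsP; exists k.
    by rewrite hB kC.
  by apply: piece_closed BP hB _ hk; rewrite in_setD kC.
have [_ e0B] := connect_within closedB gB ge0.
by move: (subsetP (pieces_sub BP) e0 e0B); rewrite in_setD e0C.
Qed.

Lemma sum_card_pieces S : (\sum_(B in pieces S) #|B| = #|S|)%N.
Proof. by rewrite (card_partition (pieces_partition S)). Qed.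

End LineConnectivity.

Section ClawStep.
Variables (R : realType) (V : finType) (N : nat) (ends : 'I_N -> {set V}).
Hypothesis ends2 : forall e, #|ends e| = 2.
Hypothesis ends_inj : injective ends.
Implicit Types (S T B C : {set 'I_N}) (e f g : 'I_N) (z : V).
Local Notation gram := (gram R ends).

Lemma other_end_unique e v z z' : v \in ends e -> z \in ends e -> z' \in ends e ->
  z != v -> z' != v -> z = z'.
Proof.
move=> ve ze ze' zv zv'; have /cards2P[a [b [ab E]]] : #|ends e| == 2 by rewrite ends2.
move: ve ze ze' zv zv'; rewrite E !inE.
by case/orP=> /eqP->; case/orP=> /eqP->; case/orP=> /eqP->; rewrite ?eqxx.
Qed.

(** A piece of the complement of a star C at v that avoids v is attached at the far
    end of an edge of C; distinct pieces use distinct edges. *)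
Lemma pieces_at_leaves S C v (P : {set {set 'I_N}}) :
  line_connected ends S -> C \subset S -> C != set0 ->
  (forall e, e \in C -> v \in ends e) ->
  P \subset pieces ends (S :\: C) ->
  (forall B e, B \in P -> e \in B -> v \notin ends e) ->
  exists (port : {set 'I_N} -> V),
    (forall B, B \in P -> star ends B (port B) != set0 /\
       (exists2 e, e \in C & port B \in ends e)) /\ (#|P| <= #|C|)%N.
Proof.
move=> connS CS /set0Pn[e0 e0C] Cv /subsetP PP Pv.
have port1 B : exists p : V * 'I_N, B \in P ->
    [/\ star ends B p.1 != set0, p.2 \in C, p.1 \in ends p.2 & p.1 != v].
  have [BP|] := boolP (B \in P); last by exists (v, e0).
  have [f [e [fB eC /meetP[z zf ze]]]] := piece_meets connS CS e0C (PP _ BP).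
  exists (z, e) => _; split=> //=.
    by apply/set0Pn; exists f; rewrite inE fB.
  by apply: contraTneq zf => ->; exact: Pv BP fB.
have [p pP] := fin_all_exists port1.
exists (fun B => (p B).1); split.
  by move=> B /pP[h1 h2 h3 _]; split=> //; exists (p B).2.
have inj : {in P &, injective (fun B => (p B).2)}.
  move=> B B' BP BP' /= E.
  have [/set0Pn[f]] := pP B BP; rewrite inE => /andP[fB zf] eC ze zv.
  have [/set0Pn[f']] := pP B' BP'; rewrite inE => /andP[fB' zf'] _ ze' zv'.
  rewrite -E in ze'; have zz := other_end_unique (Cv _ eC) ze ze' zv zv'.
  have fB2 : f' \in B.
    apply: piece_closed (PP _ BP) fB _ _.
      exact: subsetP (pieces_sub (PP _ BP')) _ fB'.
    by apply/meetP; exists (p B).1 => //; rewrite zz.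
  have /and3P[_ trivP _] := pieces_partition ends (S :\: C).
  by rewrite -(def_pblock trivP (PP _ BP) fB2) (def_pblock trivP (PP _ BP') fB').
rewrite -(card_in_imset inj); apply: subset_leq_card.
by apply/subsetP => _ /imsetP[B BP ->]; have [] := pP B BP.
Qed.

Lemma sub_card3 (A : {set 'I_N}) : (3 <= #|A|)%N -> exists2 C : {set 'I_N}, C \subset A & #|C| = 3.
Proof.
move=> A3; exists [set e in take 3 (enum A)].
  by apply/subsetP => e; rewrite inE => /mem_take; rewrite mem_enum.
rewrite cardsE (card_uniqP _) ?take_uniq ?enum_uniq // size_takel //.
by rewrite -cardE.
Qed.

(** The cases differ in the way the pieces are attached to the claw C. If an
    edge outside C contains v, join only the piece B0 of that edge, all of whose
    edges at v meet all three edges of C. Otherwise every piece meets C at the far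
    end of one of its edges, so there are at most three pieces. *)
Lemma claw_step (t : R) S v : 2 <= t -> t <= 4 -> line_connected ends S ->
  (3 <= #|star ends S v|)%N ->
  (forall B, (#|B| < #|S|)%N -> line_connected ends B -> B != set0 ->
     path_sum (t - 2) #|B|.+1 <= psi t (gram B)) ->
  path_sum (t - 2) #|S|.+1 <= psi t (gram S).
Proof.
move=> t2 t4 connS deg3 IH.
have [C Cstar C3] := sub_card3 deg3.
have CS : C \subset S by apply: subset_trans Cstar _; apply/subsetP => e; rewrite inE => /andP[].
have Cv e : e \in C -> v \in ends e by move=> /(subsetP Cstar); rewrite inE => /andP[].
have C0 : C != set0 by rewrite -card_gt0 C3.
pose P := pieces ends (S :\: C).
have partP : partition P (S :\: C) := pieces_partition ends _.
have cardR : (#|S :\: C| + 3 = #|S|)%N.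
  by rewrite cardsD (setIidPr CS) C3 subnK // -C3 subset_leq_card.
pose ms := [seq #|B| | B : {set 'I_N} <- enum P].
have sms : size ms = #|P| by rewrite size_map -cardE.
have summs : (4 + sumn ms = #|S|.+1)%N.
  by rewrite sumnE big_map big_enum /= sum_card_pieces -cardR addn3.
have IHP : \sum_(m <- ms) path_sum (t - 2) m.+1 <= \sum_(B in P) psi t (gram B).
  rewrite big_map big_enum /=; apply: ler_sum => B BP; apply: IH.
  - by have := subset_leq_card (pieces_sub BP); lia.
  - exact: piece_connected BP.
  exact: piece_neq0 BP.
have s0 : 0 <= t - 2 by lra.
have s2 : t - 2 <= 2 by lra.
rewrite -summs.
have [none|some] := boolP (star ends (S :\: C) v == set0).
  (* With q attached pieces, kap = 1 and b = 3/10 give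
     lam = (6 + 2 b q - b^2 q) / (3 + b^2 q); for q <= 1, b = 0 and lam = 2. *)
  have Pv B e : B \in P -> e \in B -> v \notin ends e.
    move=> BP eB; apply/negP => ve.
    have : e \in star ends (S :\: C) v by rewrite in_set ve (subsetP (pieces_sub BP) e eB).
    by rewrite (eqP none) in_set0.
  have [port [portP cP]] := pieces_at_leaves connS CS C0 Cv (subxx P) Pv.
  rewrite C3 in cP.
  have kap1 B f : B \in P -> f \in star ends B (port B) -> 1 <= \sum_(e in C) gram S e f.
    move=> BP; rewrite inE => /andP[fB zf]; have [_ [e eC ze]] := portP B BP.
    rewrite (bigD1 e) //=; apply: le_trans (_ : gram S e f <= _).
      apply: gram_ge1 ze zf; first exact: subsetP eC.
      by have := subsetP (pieces_sub BP) f fB; rewrite inE => /andP[].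
    by rewrite lerDl sumr_ge0 // => g _; exact: gram_ge0.
  case: (ltngtP #|P| 2) => cP2.
  - have q1 : (size ms <= 1)%N by rewrite sms; lia.
    apply: le_trans (path_sum_le1 s0 s2 q1) _.
    have H : \sum_(B in P) psi t (gram B) + (2 - (t - 2)) ^+ 2 <= psi t (gram S).
      apply: (@psi_claw R V N ends ends2 t S C v P set0 (fun=> v) 0 0 2) => //.
      - exact: sub0set.
      - by move=> B; rewrite in_set0.
      - by move=> B f; rewrite in_set0.
      by rewrite cards0; lra.
    by apply: le_trans H; rewrite lerD2r.
  - have q3 : size ms = 3 by rewrite sms; apply/eqP; rewrite eqn_leq cP cP2.
    apply: le_trans (path_sum_le3 s0 s2 q3) _.
    have H := @psi_claw R V N ends ends2 t S C v P P port 1 (3 / 10) (251 / 109)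
      t2 CS C3 Cv partP (subxx _) (fun B BP => proj1 (portP B BP)) kap1.
    apply: le_trans (H _ _ _ _); rewrite ?lerD2r //; try lra.
    by rewrite -sms q3; lra.
  have q2 : size ms = 2 by rewrite sms.
  apply: le_trans (path_sum_le2 s0 s2 q2) _.
  have H := @psi_claw R V N ends ends2 t S C v P P port 1 (3 / 10) (117 / 53)
    t2 CS C3 Cv partP (subxx _) (fun B BP => proj1 (portP B BP)) kap1.
  apply: le_trans (H _ _ _ _); rewrite ?lerD2r //; try lra.
  by rewrite -sms q2; lra.
have [f0] := set0Pn _ some; rewrite inE => /andP[f0R vf0].
have /and3P[/eqP coverP trivP _] := partP.
pose B0 := pblock P f0.
have B0P : B0 \in P by apply: pblock_mem; rewrite coverP.
have f0B0 : f0 \in B0 by rewrite mem_pblock coverP.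
have P'v B e : B \in P :\ B0 -> e \in B -> v \notin ends e.
  rewrite !inE => /andP[BB0 BP] eB; apply: contra BB0 => ve.
  have f0B : f0 \in B.
    by apply: piece_closed BP eB f0R _; apply/meetP; exists v.
  by rewrite /B0 (def_pblock trivP BP f0B).
have [port [_ cP]] := pieces_at_leaves connS CS C0 Cv (subsetDl P [set B0]) P'v.
have q4 : (size ms <= 4)%N.
  by rewrite C3 in cP; rewrite sms (cardsD1 B0 P) B0P add1n.
apply: le_trans (path_sum_le4 s0 s2 q4) _.
(* One attached piece, kap = 3 and b = 4/5: lam = (6 + 6 b - b^2) / (3 + b^2). *)
have H := @psi_claw R V N ends ends2 t S C v P [set B0] (fun=> v) 3 (4 / 5) (254 / 91)
  t2 CS C3 Cv partP _ _ _.
apply: le_trans (H _ _ _ _ _ _ _); rewrite ?lerD2r //; try lra.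
- by rewrite sub1set.
- move=> B /set1P ->; apply/set0Pn; exists f0; by rewrite inE f0B0.
- move=> B f /set1P ->; rewrite inE => /andP[fB zf].
  have -> : 3 = \sum_(e in C) 1 :> R by rewrite sumr_const C3.
  apply: ler_sum => e eC; apply: (gram_ge1 _ (z := v)) => //; last exact: Cv.
    exact: subsetP eC.
  by have := subsetP (pieces_sub B0P) f fB; rewrite inE => /andP[].
by rewrite cards1; lra.
Qed.
End ClawStep.

(** * Edge sets of maximum degree two *)

Section OrthogonalEigenvectors.
Variable R : rcfType.

Lemma qform1_gt0 n (u : 'cV[R]_n) i : u i 0 != 0 -> 0 < qform 1%:M u.
Proof.
move=> ui; rewrite lt_def qform1_ge0 andbT qform1E; apply: contra ui => /eqP s0.
have nneg k : true -> 0 <= u k 0 ^+ 2 by rewrite sqr_ge0.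
by have /eqP := psumr_eq0P nneg s0 isT (i := i); rewrite sqrf_eq0.
Qed.

Lemma eigenvectors_orthogonal n (A : 'M[R]_n) (a b : R) u v : A^T = A ->
  A *m u = a *: u -> A *m v = b *: v -> a != b -> bform 1%:M u v = 0.
Proof.
move=> symA Au Av ab; apply/eqP.
have e : a * bform 1%:M u v = b * bform 1%:M u v.
  rewrite -bformZl -bformZr -Au -Av /bform !mulmx1 trmx_mul symA.
  by rewrite -mulmxA.
have : (a - b) * bform 1%:M u v == 0 by rewrite mulrBl e subrr.
by rewrite mulf_eq0 subr_eq0 (negPf ab).
Qed.

(** Trial matrix: the sum of (a i - t)_+ u u^T / |u|^2 over the eigenvectors u. *)
Lemma psi_ge_eigenvectors n (t : R) (A : 'M[R]_n) (I : finType) (u : I -> 'cV[R]_n)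
    (a : I -> R) : A^T = A ->
  (forall i, A *m u i = a i *: u i) -> (forall i, 0 < qform 1%:M (u i)) ->
  (forall i j, i != j -> bform 1%:M (u i) (u j) = 0) ->
  \sum_i pos2 (a i - t) <= psi t A.
Proof.
move=> symA Au u0 orth.
pose c i := Num.max (a i - t) 0 / qform 1%:M (u i).
have c0 i : 0 <= c i by rewrite divr_ge0 ?le_max ?lexx ?orbT // ltW.
pose W i := u i *m (u i)^T; pose Y := \sum_i c i *: W i.
have psdY : psdmx Y.
  apply: psdmx_sum => i; split; first by rewrite linearZ /= trmx_mul trmxK.
  move=> v; rewrite /qform -scalemxAr -scalemxAl mxE mulr_ge0 //.
  rewrite /W mulmxA -(mulmxA (v^T *m u i)).
  have -> : (u i)^T *m v = (v^T *m u i)^T by rewrite trmx_mul trmxK.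
  exact: mulmx_tr_ge0.
apply: le_trans (psi_ge_trial t symA psdY).
have max0 i : Num.max (a i - t) 0 = c i * qform 1%:M (u i).
  by rewrite /c divfK // gt_eqF.
have tr1 : \tr ((A - t%:M) *m Y) = \sum_i (a i - t) * Num.max (a i - t) 0.
  rewrite /Y mulmx_sumr raddf_sum; apply: eq_bigr => i _ /=.
  rewrite -scalemxAr mxtraceZ mxtrace_mul_outer qformD qformN qform_scalar max0.
  have -> : qform A (u i) = a i * qform 1%:M (u i).
    by rewrite /qform -mulmxA Au -scalemxAr mxE mulmx1.
  ring.
have tr2 : \tr (Y *m Y) = \sum_i Num.max (a i - t) 0 ^+ 2.
  rewrite {1}/Y mulmx_suml raddf_sum; apply: eq_bigr => i _ /=.
  rewrite /Y mulmx_sumr raddf_sum (bigD1 i) //= big1 ?addr0 => [|j ji].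
    rewrite -scalemxAl -scalemxAr !mxtraceZ mxtrace_mul_outer max0.
    have -> : qform (W i) (u i) = qform 1%:M (u i) ^+ 2.
      rewrite /qform /W mulmxA -(mulmxA ((u i)^T *m u i)) mulmx1.
      by rewrite [(u i)^T *m u i]mx11_scalar mul_scalar_mx !mxE eqxx mulr1n expr2.
    ring.
  rewrite -scalemxAl -scalemxAr !mxtraceZ /W -mulmxA (mulmxA (u i)^T).
  have -> : (u i)^T *m u j = 0.
    apply/matrixP => k l; rewrite !ord1 [RHS]mxE.
    by have := orth i j; rewrite /bform mulmx1 eq_sym => ->.
  by rewrite mul0mx mulmx0 mxtrace0 !mulr0.
rewrite tr1 tr2 mulr_sumr -sumrB; apply: ler_sum => i _; rewrite /pos2.
by case: (lerP (a i - t) 0) => h; lra.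
Qed.
End OrthogonalEigenvectors.

Section LowDegree.
Variables (R : rcfType) (V : finType) (N : nat) (ends : 'I_N -> {set V}).
Hypothesis ends2 : forall e, #|ends e| = 2.
Hypothesis ends_inj : injective ends.
Variable S : {set 'I_N}.
Hypothesis connS : line_connected ends S.
Hypothesis deg2 : forall z, (#|star ends S z| <= 2)%N.
Local Notation gram := (gram R ends).
Local Notation meet := (edges_meet ends).

(** Two of the three edges a, b, c contain the same end of e. *)
Lemma no_three_neighbors e a b c : e \in S -> a \in S -> b \in S -> c \in S ->
  uniq [:: e; a; b; c] -> meet e a -> meet e b -> meet e c -> False.
Proof.
move=> eS aS bS cS /= /and4P[]; rewrite !inE !negb_or => /and3P[ea eb ec].
move=> /andP[ab ac] bc _ /meetP[x xe xa] /meetP[y ye yb] /meetP[z ze zc].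
have no2 f g v : f \in S -> g \in S -> e != f -> e != g -> f != g ->
    v \in ends e -> v \in ends f -> v \in ends g -> False.
  move=> fS gS ef eg fg ve vf vg; have := deg2 v; rewrite leqNgt => /negP; apply.
  have : (#|[set e; f; g]| <= #|star ends S v|)%N.
    apply: subset_leq_card; apply/subsetP => h; rewrite !inE.
    by move=> /orP[/orP[]|] /eqP ->; rewrite ?eS ?fS ?gS.
  by rewrite -setUA cardsU1 !inE negb_or ef eg cards2 fg.
have [xy|xy] := eqVneq x y; first by apply: (no2 a b x) => //; rewrite xy.
have [xz|xz] := eqVneq x z; first by apply: (no2 a c x) => //; rewrite xz.
have yz := other_end_unique ends2 xe ye ze; rewrite eq_sym xy eq_sym xz in yz.
by apply: (no2 b c y) => //; rewrite yz.
Qed.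

(** A longest sequence p of distinct edges of S in which consecutive edges meet
    exhausts S. Indeed an edge outside p meeting an inner member would be its third
    neighbour, and one meeting an extreme member would prolong p. For the same
    reason only the two extreme members can meet without being consecutive; c
    records whether they do, that is, whether S is a cycle. *)
Lemma low_degree_enumeration : S != set0 ->
  exists (p : seq 'I_N) (c : bool), [/\ uniq p, p =i S, c -> (2 < size p)%N &
    forall e0 i l, (i < size p)%N -> (l < size p)%N ->
    gram S (nth e0 p i) (nth e0 p l) =
    2 * (l == i)%:R + (l == i.+1)%:R + (l.+1 == i)%:R +
    c%:R * ((i == 0%N) && (l.+1 == size p) || (i.+1 == size p) && (l == 0%N))%:R].
Proof.
move=> /set0Pn[s0 s0S].
pose good (p : seq 'I_N) := [&& uniq p, all (mem S) p & sorted meet p].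
pose ok k := [exists p : k.-tuple 'I_N, good p].
have ok1 : exists k, ok k.
  by exists 1%N; apply/existsP; exists [tuple s0]; rewrite /good /= s0S.
have okN k : ok k -> (k <= #|S|)%N.
  case/existsP=> p /and3P[up pS _]; rewrite -(size_tuple p) -(card_uniqP up).
  by apply: subset_leq_card; apply/subsetP => e /(allP pS).
case: (ex_maxnP ok1 okN) => k /existsP[p0 good_p] kmax.
have max_good q : good q -> (size q <= k)%N.
  by move=> gq; apply: kmax; apply/existsP; exists (in_tuple q).
move: (tval p0) (size_tuple p0) good_p => p szp good_p {p0}.
have /and3P[up /allP pS sp] := good_p.
have nthS e0 i : (i < size p)%N -> nth e0 p i \in S by move=> ip; apply/pS/mem_nth.
have next e0 i : (i.+1 < size p)%N -> meet (nth e0 p i) (nth e0 p i.+1).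
  by move=> ip; apply: (sortedP e0 sp).
have p0 : (0 < size p)%N.
  by rewrite szp; apply: kmax; apply/existsP; exists [tuple s0]; rewrite /good /= s0S.
have closed f e : e \in p -> f \in S -> meet e f -> f \in p.
  move=> ep fS ef; apply/negPn/negP => fp.
  pose i := index e p; have ip : (i < size p)%N by rewrite index_mem.
  have ei : nth s0 p i = e by rewrite nth_index.
  have [i0|i0] := posnP i.
    suff : good (f :: p) by move/max_good; rewrite /= szp ltnn.
    rewrite /good /= fp up fS; have /allP -> := pS.
    rewrite /=; case: (p) sp ei => // x q /=; rewrite i0 /= => -> ->.
    by rewrite meet_sym ef.
  have [il|il] := eqVneq i.+1 (size p).
    suff : good (rcons p f) by move/max_good; rewrite size_rcons szp ltnn.
    rewrite /good rcons_uniq fp up all_rcons /= fS; have /allP -> := pS.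
    have el : e = last s0 p by rewrite -nth_last -il /= ei.
    by rewrite /=; case: (p) sp el => // x q /= spq el; rewrite rcons_path spq -el.
  have ip1 : (i.+1 < size p)%N by rewrite ltn_neqAle il ip.
  have im : (i.-1 < size p)%N by lia.
  have u4 : uniq [:: e; nth s0 p i.-1; nth s0 p i.+1; f].
    have neq j : (j < size p)%N -> nth s0 p j != f.
      by move=> jp; apply: contraNneq fp => <-; exact: mem_nth.
    rewrite /= !in_cons !in_nil !orbF !negb_or -ei !nth_uniq // !neq // !andbT.
    by apply/andP; split; lia.
  apply: (no_three_neighbors (pS _ ep) (nthS _ _ im) (nthS _ _ ip1) fS u4) => //.
    by rewrite meet_sym -ei -[in nth s0 p i](prednK i0) next // prednK.
  by rewrite -ei next.
have pSe : p =i S.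
  move=> e; apply/idP/idP => [/pS //|eS].
  have hp : nth s0 p 0 \in p by exact: mem_nth.
  have closedB g h : g \in [set x in p] -> line_rel ends S g h -> h \in [set x in p].
    by rewrite !inE => gp /and3P[_ hS gh]; exact: closed gp hS gh.
  have hB : nth s0 p 0 \in [set x in p] by rewrite inE.
  have [_] := connect_within closedB hB (connS (pS _ hp) eS).
  by rewrite inE.
have far e0 i l : (i.+1 < l)%N -> (l < size p)%N -> meet (nth e0 p i) (nth e0 p l) ->
    i = 0%N /\ l.+1 = size p.
  move=> il lp m_il; have ip : (i < size p)%N by lia.
  split.
    case: (posnP i) => // i0; exfalso.
    have im : (i.-1 < size p)%N by lia.
    have ip1 : (i.+1 < size p)%N by lia.
    have u4 : uniq [:: nth e0 p i; nth e0 p i.-1; nth e0 p i.+1; nth e0 p l].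
      by rewrite /= !in_cons !in_nil !orbF !negb_or !nth_uniq // !andbT; apply/and3P; split; lia.
    apply: (no_three_neighbors (nthS _ _ ip) (nthS _ _ im) (nthS _ _ ip1) (nthS _ _ lp) u4) => //.
      by rewrite meet_sym -[in X in meet _ X](prednK i0) next // prednK.
    by rewrite next.
  apply/eqP; apply/negPn/negP => lm; have lp1 : (l.+1 < size p)%N by lia.
  have l0 : (0 < l)%N by lia.
  have lm1 : (l.-1 < size p)%N by lia.
  have u4 : uniq [:: nth e0 p l; nth e0 p l.-1; nth e0 p l.+1; nth e0 p i].
    by rewrite /= !in_cons !in_nil !orbF !negb_or !nth_uniq // !andbT; apply/and3P; split; lia.
  apply: (no_three_neighbors (nthS _ _ lp) (nthS _ _ lm1) (nthS _ _ lp1) (nthS _ _ ip) u4).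
  - by rewrite meet_sym -[in X in meet _ X](prednK l0) next // prednK.
  - by rewrite next.
  by rewrite meet_sym.
pose c := (2 < size p)%N && meet (nth s0 p 0) (nth s0 p (size p).-1).
exists p, c; split=> //; first by case/andP.
have gram_meet e f : e \in S -> f \in S -> e != f -> gram S e f = (meet e f)%:R.
  move=> eS fS ef; rewrite mxE eS fS /=; congr (_%:R).
  have := meet_le1 ends2 ends_inj ef; rewrite /edges_meet -card_gt0.
  by case: #|_| => [|[]].
have lt e0 i l : (i < l)%N -> (l < size p)%N -> gram S (nth e0 p i) (nth e0 p l) =
    (l == i.+1)%:R + c%:R * ((i == 0%N) && (l.+1 == size p))%:R.
  move=> il lp; have ip := ltn_trans il lp.
  rewrite gram_meet ?nthS ?nth_uniq ?(ltn_eqF il) //.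
  have [li|li] := eqVneq l i.+1.
    rewrite li next -?li // mulr1n.
    rewrite -natrM mulnb (_ : c && _ = false) ?addr0 //; apply/negbTE/negP.
    by rewrite /c => /andP[/andP[m2 _] /andP[/eqP i0 /eqP m2']]; lia.
  have il1 : (i.+1 < l)%N by rewrite ltn_neqAle eq_sym li.
  rewrite add0r -natrM mulnb; congr (nat_of_bool _)%:R.
  have m2 : (2 < size p)%N by lia.
  apply/idP/and3P => [m_il|[cc /eqP i0 /eqP lm]].
    have [i0 lm] := far _ _ _ il1 lp m_il; split; rewrite ?i0 ?lm //.
    rewrite /c m2 -lm /= (set_nth_default e0) //= (set_nth_default e0 s0) //.
    by rewrite -i0.
  move: cc; rewrite /c m2 -lm i0 /= (set_nth_default e0) //.
  by rewrite (set_nth_default e0 s0).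
move=> e0 i l ip lp.
have cF : c -> (2 < size p)%N by case/andP.
case: (ltngtP i l) => [il|li|<-].
- rewrite lt // ?(gtn_eqF il) /= mulr0n mulr0 add0r.
  have -> : (l.+1 == i) = false by lia.
  have -> : (i.+1 == size p) = false by apply/negbTE; rewrite neq_ltn (leq_ltn_trans il lp).
  by rewrite addr0 andFb orbF.
- rewrite -gram_sym mxE lt // ?(ltn_eqF li) /= mulr0n mulr0 add0r.
  have -> : (l == i.+1) = false by lia.
  have -> : (l.+1 == size p) = false by apply/negbTE; rewrite neq_ltn (leq_ltn_trans li ip).
  by rewrite add0r andbF orFb [i == _]eq_sym andbC.
rewrite gram_diag ?nthS // ?eqxx /= mulr1n mulr1.
have -> : (i == i.+1) = false by lia.
have -> : (i.+1 == i) = false by lia.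
suff -> : c%:R * ((i == 0%N) && (i.+1 == size p) || (i.+1 == size p) && (i == 0%N))%:R
   = 0 :> R by rewrite !addr0.
rewrite -natrM mulnb [X in _ || X]andbC orbb.
have [cc|] := boolP c; last by [].
by have [i0|] := eqVneq i 0%N; [have -> : (i.+1 == size p) = false by have := cF cc; lia|].
Qed.

End LowDegree.

Section PathOrCycle.
Variables (R : realType) (V : finType) (N : nat) (ends : 'I_N -> {set V}).
Hypothesis ends2 : forall e, #|ends e| = 2.
Hypothesis ends_inj : injective ends.
Variables (S : {set 'I_N}) (p : seq 'I_N) (c : bool).
Local Notation gram := (gram R ends).
Hypotheses (up : uniq p) (pS : p =i S) (c_gt2 : c -> (2 < size p)%N).
Hypothesis gramE : forall e0 i l, (i < size p)%N -> (l < size p)%N ->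
    gram S (nth e0 p i) (nth e0 p l) =
    2 * (l == i)%:R + (l == i.+1)%:R + (l.+1 == i)%:R +
    c%:R * ((i == 0%N) && (l.+1 == size p) || (i.+1 == size p) && (l == 0%N))%:R.
Hypothesis p_gt0 : (0 < size p)%N.
Let m := size p.
Implicit Types h : nat -> R.

(** Position i of the enumeration carries the value of h at i + 1, so that the
    indices 0 and m + 1 are free for boundary values. *)
Definition along h : 'cV[R]_N := \col_e if e \in S then h (index e p).+1 else 0.

Lemma sum_along (F : 'I_N -> R) e0 :
  \sum_(e in S) F e = \sum_(l < m) F (nth e0 p l).
Proof.
rewrite -(big_mkord predT (fun l => F (nth e0 p l))) -(big_nth e0 predT F).
rewrite -big_enum; apply: perm_big; apply: uniq_perm => //; first exact: enum_uniq.
by move=> e; rewrite mem_enum pS.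
Qed.

Lemma along_nth h e0 l : (l < m)%N -> along h (nth e0 p l) 0 = h l.+1.
Proof. by move=> lm; rewrite mxE -pS mem_nth // index_uniq. Qed.

Lemma bform1_along h h' : bform 1%:M (along h) (along h') = \sum_(l < m) h l.+1 * h' l.+1.
Proof.
have [e0 _] : exists e0, e0 \in p by case: (p) p_gt0 => // e q _; exists e; rewrite mem_head.
rewrite /bform mulmx1 mxE (bigID (fun e => e \in S)) /= [X in _ + X]big1 ?addr0.
  rewrite (sum_along _ e0); apply: eq_bigr => l _.
  by rewrite mxE !along_nth.
by move=> e /negPf eS; rewrite !mxE eS mul0r.
Qed.

(** The boundary conditions are h 0 = h (m + 1) = 0 for a path (c = 0) and
    periodicity for a cycle (c = 1). *)
Lemma gram_along h (a : R) :
  h 0%N = c%:R * h m -> h m.+1 = c%:R * h 1%N ->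
  (forall k, h k + h k.+2 = a * h k.+1) ->
  gram S *m along h = (2 + a) *: along h.
Proof.
move=> h0 hm hrec; apply/colP => e; rewrite [RHS]mxE mxE.
have [eS|eS] := boolP (e \in S); last first.
  rewrite mxE (negPf eS) mulr0 big1 // => f _.
  by rewrite mxE (negPf eS) mul0r.
have ep : e \in p by rewrite pS.
pose i := index e p; have im : (i < m)%N by rewrite index_mem.
have ei : nth e p i = e by rewrite nth_index.
rewrite (bigID (fun f => f \in S)) /= [X in _ + X]big1 ?addr0; last first.
  by move=> f /negPf fS; rewrite mxE fS andbF mul0r.
have hi : along h e 0 = h i.+1 by have := along_nth h e im; rewrite ei.
rewrite (sum_along _ e) hi.
have E (l : 'I_m) : gram S e (nth e p l) * along h (nth e p l) 0 =
    2 * ((l == i :> nat)%:R * h l.+1) + (l == i.+1 :> nat)%:R * h l.+1 +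
    (0 < i)%N%:R * ((l == i.-1 :> nat)%:R * h l.+1) +
    c%:R * ((i == 0%N)%:R * ((l == m.-1 :> nat)%:R * h l.+1) +
            (i.+1 == m)%:R * ((l == 0%N :> nat)%:R * h l.+1)).
  have lm := ltn_ord l.
  rewrite along_nth //; have := gramE e im lm; rewrite ei -/m => ->.
  have -> : (l.+1 == i) = (0 < i)%N && (l == i.-1 :> nat) by lia.
  have -> : (l.+1 == m) = (l == m.-1 :> nat) by lia.
  have -> : c%:R * (((i == 0%N) && (l == m.-1 :> nat) || (i.+1 == m) && (l == 0%N :> nat))%:R) =
     c%:R * ((i == 0%N)%:R * (l == m.-1 :> nat)%:R + (i.+1 == m)%:R * (l == 0%N :> nat)%:R) :> R.
    have [cc|] := boolP c; last by rewrite !mul0r.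
    congr (_ * _); rewrite -!natrM !mulnb -natrD; congr (_%:R).
    by have := c_gt2 cc; rewrite -/m; lia.
  by rewrite -mulnb natrM; ring.
under eq_bigr do rewrite E.
rewrite !big_split /= -!mulr_sumr big_split /= -!mulr_sumr.
rewrite !(sum_ord_pick m _ (fun l => h l.+1)).
have m0 : (0 < m)%N := p_gt0.
have -> : (i.-1 < m)%N by apply: leq_ltn_trans im; exact: leq_pred.
have -> : (m.-1 < m)%N by rewrite prednK.
rewrite im m0 (prednK m0).
rewrite !mul1r.
have r1 : (i.+1 < m)%N%:R * h i.+2 + c%:R * ((i.+1 == m)%:R * h 1%N) = h i.+2.
  have [->|im'] := eqVneq i.+1 m; first by rewrite ltnn mul0r add0r mul1r hm.
  by rewrite ltn_neqAle im' im mul1r mul0r mulr0 addr0.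
have r2 : (0 < i)%N%:R * h i.-1.+1 + c%:R * ((i == 0%N)%:R * h m) = h i.
  have [->|i0] := posnP i; first by rewrite mul0r add0r mul1r h0.
  by rewrite mul1r prednK // ?gtn_eqF // mul0r mulr0 addr0.
have := hrec i; rewrite mulrDr; lra.
Qed.

End PathOrCycle.

Section Waves.
Variable R : realType.
Implicit Types (x : R) (k n : nat).

Lemma sin_rec x k : sin (k%:R * x) + sin (k.+2%:R * x) = 2 * cos x * sin (k.+1%:R * x).
Proof.
have -> : k%:R * x = k.+1%:R * x - x by rewrite -natr1; ring.
have -> : k.+2%:R * x = k.+1%:R * x + x by rewrite -[k.+2%:R]natr1; ring.
by rewrite (sinB (k.+1%:R * x) x) (sinD (k.+1%:R * x) x); ring.
Qed.

Lemma cos_rec x k : cos (k%:R * x) + cos (k.+2%:R * x) = 2 * cos x * cos (k.+1%:R * x).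
Proof.
have -> : k%:R * x = k.+1%:R * x - x by rewrite -natr1; ring.
have -> : k.+2%:R * x = k.+1%:R * x + x by rewrite -[k.+2%:R]natr1; ring.
by rewrite (cosB (k.+1%:R * x) x) (cosD (k.+1%:R * x) x); ring.
Qed.

Lemma cos_nat2pi k : cos (pi *+ (2 * k)) = 1 :> R.
Proof. by rewrite -[_ *+ _]add0r (alternatingn (@cosDpi R)) cos0 exprM sqrrN !expr1n mulr1. Qed.

(** The summand changes its sign under l -> n - l. *)
Lemma sum_cos_sin x n : sin (n%:R * x) = 0 -> cos (n%:R * x) = 1 ->
  \sum_(l < n) cos (l.+1%:R * x) * sin (l.+1%:R * x) = 0.
Proof.
move=> sn cn; pose F k := cos (k%:R * x) * sin (k%:R * x).
have Frefl k : (k <= n)%N -> F (n - k)%N = - F k.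
  move=> kn; rewrite /F natrB // mulrBl (cosB (n%:R * x)) (sinB (n%:R * x)) sn cn.
  ring.
have Fn : F n = 0 by rewrite /F sn mulr0.
have F0 : F 0%N = 0 by rewrite /F mul0r sin0 mulr0.
rewrite -(big_mkord predT (fun l => F l.+1)).
have E : \sum_(0 <= l < n) F l.+1 = \sum_(0 <= l < n) F l.
  have := @big_nat_recr _ _ +%R n 0 F isT.
  by rewrite big_nat_recl //= F0 Fn add0r addr0.
rewrite E; have : \sum_(0 <= l < n) F l = - \sum_(0 <= l < n) F l.
  rewrite -{1}E big_nat_rev /= -sumrN big_nat [RHS]big_nat.
  apply: eq_bigr => l /andP[_ ln]; rewrite add0n -Frefl; last exact: ltnW.
  by rewrite subnSK.
lra.
Qed.
End Waves.

Section LowDegreeStep.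
Variables (R : realType) (V : finType) (N : nat) (ends : 'I_N -> {set V}).
Hypothesis ends2 : forall e, #|ends e| = 2.
Hypothesis ends_inj : injective ends.
Local Notation gram := (gram R ends).

Section Enumerated.
Variables (S : {set 'I_N}) (p : seq 'I_N) (c : bool).
Hypotheses (up : uniq p) (pS : p =i S) (c_gt2 : c -> (2 < size p)%N).
Hypothesis gramE : forall e0 i l, (i < size p)%N -> (l < size p)%N ->
    gram S (nth e0 p i) (nth e0 p l) =
    2 * (l == i)%:R + (l == i.+1)%:R + (l.+1 == i)%:R +
    c%:R * ((i == 0%N) && (l.+1 == size p) || (i.+1 == size p) && (l == 0%N))%:R.
Hypothesis p_gt0 : (0 < size p)%N.
Let m := size p.
Local Notation along := (@along R N S p).

Lemma along_gt0 (h : nat -> R) l : (l < m)%N -> h l.+1 != 0 -> 0 < qform 1%:M (along h).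
Proof.
move=> lm hl; have [e0 _] : exists e0, e0 \in p by case: (p) p_gt0 => // e q _; exists e; rewrite mem_head.
by apply: (@qform1_gt0 _ _ _ (nth e0 p l)); rewrite along_nth.
Qed.

(** The waves sin (k (j+1) pi / (m+1)) vanish at the boundary indices. *)
Lemma path_psi_ge (t : R) : ~~ c -> path_sum (t - 2) m.+1 <= psi t (gram S).
Proof.
move=> nc; have c0 : c%:R = 0 :> R by rewrite (negPf nc).
pose h (j : 'I_m) k := sin (k%:R * frac_pi R j.+1 m.+1).
pose a (j : 'I_m) := 2 + cos2 R j.+1 m.+1.
have ah j : gram S *m along (h j) = a j *: along (h j).
  apply: gram_along up pS c_gt2 gramE p_gt0 _ _ _ _ _.
  - by rewrite /h mul0r sin0 c0 mul0r.
  - by rewrite /h frac_piK // sin_natpi c0 mul0r.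
  by move=> k; rewrite /h sin_rec.
have h0 j : 0 < qform 1%:M (along (h j)).
  apply: (@along_gt0 _ 0) => //; rewrite /h mul1r gt_eqF // sin_gt0_pi //.
  rewrite /frac_pi divr_gt0 ?mulr_gt0 ?ltr0n ?pi_gt0 //=.
  by rewrite ltr_pdivrMr ?ltr0n // mulrC ltr_pM2l ?pi_gt0 // ltr_nat ltnS ltn_ord.
have := @psi_ge_eigenvectors R N t (gram S) _ (fun j => along (h j)) a
  (gram_sym _ _ _) ah h0.
rewrite /path_sum /fsum big_add1 /= big_mkord => H; apply: le_trans (H _).
  by apply: ler_sum => j _; rewrite /a (_ : 2 + _ - t = cos2 R j.+1 m.+1 - (t - 2)) //; ring.
move=> i j ij; apply: eigenvectors_orthogonal (gram_sym _ _ _) (ah i) (ah j) _.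
apply: contra ij; rewrite /a => /eqP /addrI /cos2_inj E.
by apply/eqP/val_inj/eq_add_S/E; rewrite // ltnW // ltnS ltn_ord.
Qed.

(** The constant, and for 0 < i <= m/4 the cosine and the sine of frequency
    2 i pi / m, are orthogonal. The other frequencies belong to eigenvalues at
    most 2. *)
Lemma cycle_psi_ge (t : R) : 2 <= t -> c -> path_sum (t - 2) m.+1 <= psi t (gram S).
Proof.
move=> t2 cc; have c1 : c%:R = 1 :> R by rewrite cc.
have m2 : (2 < m)%N := c_gt2 cc.
have m0 : (0 < m)%N by exact: ltn_trans m2.
pose K := (m %/ 4)%N.
have K4 (i : 'I_K) : (4 * i.+1 <= m)%N.
  by apply: leq_trans (_ : 4 * K <= m)%N; [rewrite leq_mul2l ltn_ord | rewrite mulnC leq_trunc_div].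
pose th i := frac_pi R (2 * i.+1) m.
have thm i : m%:R * th i = pi *+ (2 * i.+1) by rewrite /th frac_piK.
pose h (x : option ('I_K * bool)) k : R :=
  match x with
  | None => 1
  | Some (i, true) => cos (k%:R * th i)
  | Some (i, false) => sin (k%:R * th i)
  end.
pose a (x : option ('I_K * bool)) : R :=
  match x with None => 2 + 2 | Some (i, _) => 2 + cos2 R (2 * i.+1) m end.
have ah x : gram S *m along (h x) = a x *: along (h x).
  case: x => [[i []]|]; apply: gram_along up pS c_gt2 gramE p_gt0 _ _ _ _ _.
  - by rewrite /= c1 mul1r -/m thm cos_nat2pi mul0r cos0.
  - rewrite /= c1 !mul1r -/m -natr1 mulrDl thm mul1r addrC.
    by rewrite (alternatingn (@cosDpi R)) exprM sqrrN !expr1n mul1r.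
  - by move=> k; rewrite /= cos_rec.
  - by rewrite /= c1 mul1r -/m thm sin_natpi mul0r sin0.
  - rewrite /= c1 !mul1r -/m -natr1 mulrDl thm mul1r addrC.
    by rewrite (alternatingn (@sinDpi R)) exprM sqrrN !expr1n mul1r.
  - by move=> k; rewrite /= sin_rec.
  - by rewrite /= c1 mul1r.
  - by rewrite /= c1 mul1r.
  by move=> k /=; rewrite mulr1.
have h0 x : 0 < qform 1%:M (along (h x)).
  case: x => [[i []]|].
  - apply: (@along_gt0 _ m.-1); first by rewrite prednK.
    by rewrite prednK //= thm cos_nat2pi oner_neq0.
  - apply: (@along_gt0 _ 0) => //; rewrite /= mul1r gt_eqF // sin_gt0_pi //.
    rewrite /th /frac_pi divr_gt0 ?mulr_gt0 ?ltr0n ?pi_gt0 //=.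
    rewrite ltr_pdivrMr ?ltr0n // mulrC ltr_pM2l ?pi_gt0 // ltr_nat.
    by apply: leq_trans (K4 i); rewrite ltn_pmul2r.
  by apply: (@along_gt0 _ 0) => //=; rewrite oner_neq0.
have := @psi_ge_eigenvectors R N t (gram S) _ (fun x => along (h x)) a
  (gram_sym _ _ _) ah h0.
have s0 : 0 <= t - 2 by lra.
have cyc := path_sum_le_cycle s0 m0.
move=> H; apply: le_trans (H _).
  apply: le_trans cyc _.
  rewrite (bigD1 None) //= (reindex_omap Some id) /=; last by case=> [x|].
  have -> : 2 + 2 - t = 2 - (t - 2) by ring.
  rewrite lerD2l big_add1 /= big_mkord.
  rewrite (eq_bigl predT); last by move=> x; rewrite eqxx.
  have -> : \sum_x pos2 (a (Some x) - t) = \sum_i \sum_b pos2 (a (Some (i, b)) - t).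
    by rewrite pair_bigA; apply: eq_bigr => -[].
  rewrite mulr_sumr.
  apply: ler_sum => i _; rewrite big_bool /=.
  have -> : 2 + cos2 R (2 * i.+1) m - t = cos2 R (2 * i.+1) m - (t - 2) by ring.
  by rewrite mulr_natl mulr2n.
move=> x y xy.
have [axy|axy] := eqVneq (a x) (a y); last first.
  exact: eigenvectors_orthogonal (gram_sym _ _ _) (ah x) (ah y) axy.
have K2 (i : 'I_K) : (2 * i.+1 <= m)%N.
  by apply: leq_trans (K4 i); rewrite leq_mul2r.
have cos20 : 2 = cos2 R 0 m by rewrite /cos2 /frac_pi !mul0r cos0 mulr1.
have no0 (i : 'I_K) : cos2 R 0 m = cos2 R (2 * i.+1) m -> False.
  by move/cos2_inj => /(_ m0 (leq0n _) (K2 i)).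
case: x y xy axy => [[i b]|] [[j d]|] //=; last first.
- by move=> _ /addrI; rewrite cos20 => /no0.
- by move=> _ /addrI /esym; rewrite cos20 => /no0.
move=> ij /addrI /cos2_inj => /(_ m0 (K2 i) (K2 j)) /eqP.
rewrite eqn_pmul2l // eqSS => /eqP /val_inj ji; rewrite {}ji in ij *.
have cs : \sum_(l < m) cos (l.+1%:R * th j) * sin (l.+1%:R * th j) = 0.
  by apply: sum_cos_sin; rewrite thm ?sin_natpi ?cos_nat2pi.
case: b d ij => [] [] ; rewrite ?eqxx // => _; rewrite (bform1_along up pS p_gt0) //=.
by rewrite -[RHS]cs; apply: eq_bigr => l _; rewrite mulrC.
Qed.

End Enumerated.

Lemma low_degree_step (t : R) (S : {set 'I_N}) : 2 <= t -> line_connected ends S ->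
  S != set0 -> (forall z, (#|star ends S z| <= 2)%N) ->
  path_sum (t - 2) #|S|.+1 <= psi t (gram S).
Proof.
move=> t2 connS S0 deg2.
have [p [c [up pS c2 gE]]] := low_degree_enumeration R ends2 ends_inj connS deg2 S0.
have cS : #|S| = size p by rewrite -(card_uniqP up); apply: eq_card => e; rewrite pS.
have p0 : (0 < size p)%N by rewrite -cS card_gt0.
rewrite cS; have [cc|nc] := boolP c.
  exact: cycle_psi_ge up pS c2 gE p0 t t2 cc.
exact: path_psi_ge up pS c2 gE p0 t nc.
Qed.

Lemma line_psi_ge (t : R) (S : {set 'I_N}) : 2 <= t -> t <= 4 ->
  line_connected ends S -> S != set0 ->
  path_sum (t - 2) #|S|.+1 <= psi t (gram S).
Proof.
move=> t2 t4; have [n] := ubnP #|S|; elim: n S => // n IHn S Sn connS S0.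
have [/existsP[v vS]|/existsPn low] := boolP [exists v, (2 < #|star ends S v|)%N].
  apply: claw_step vS _ => // B BS; apply: IHn.
  exact: leq_trans BS Sn.
by apply: low_degree_step => // z; rewrite leqNgt; exact: low.
Qed.
End LowDegreeStep.

(** * From vertices to edges *)

Section Incidence.
Variables (R : rcfType) (G : sgraph).
Implicit Types (x y z : G).

Definition edge_ends (e : 'I_#|edges G|) : {set G} := enum_val e.

(** An edge determines its two ends up to order. *)
Lemma edgesE x y : ([set x; y] \in edges G) = adj x y.
Proof.
apply/imsetP/idP => [[[a b]]|xy]; last by exists (x, y); rewrite ?inE.
rewrite inE /= => ab E.
have nab : a != b by apply: contraTneq ab => ->; rewrite adj_irr.
have /set2P xab : x \in [set a; b] by rewrite -E set21.
have /set2P yab : y \in [set a; b] by rewrite -E set22.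
have nxy : x != y.
  apply: contraTneq nab => xy; rewrite xy setUid in E.
  have /set1P -> : a \in [set y] by rewrite E set21.
  have /set1P -> : b \in [set y] by rewrite E set22.
  by rewrite eqxx.
case: xab yab nxy => -> [] ->; rewrite ?eqxx // => _.
by rewrite adj_sym.
Qed.

Lemma edges_pair (E : {set G}) : E \in edges G -> exists x y, E = [set x; y] /\ adj x y.
Proof. by case/imsetP=> -[x y]; rewrite inE /= => xy ->; exists x, y. Qed.

Lemma card_edge_ends e : #|edge_ends e| = 2.
Proof.
rewrite /edge_ends; have [x [y [-> xy]]] := edges_pair (enum_valP e).
by rewrite cards2; case: eqVneq xy => [->|//]; rewrite adj_irr.
Qed.

Lemma edge_ends_inj : injective edge_ends. Proof. exact: enum_val_inj. Qed.

Lemma adj_edge x y : adj x y -> exists e, edge_ends e = [set x; y].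
Proof. by rewrite -edgesE => xy; exists (enum_rank_in xy [set x; y]); rewrite /edge_ends enum_rankK_in. Qed.

Definition incidence : 'M[R]_(#|G|, #|edges G|) :=
  \matrix_(i, e) (enum_val i \in edge_ends e)%:R.

Lemma gram_incidence : incidence^T *m incidence = gram R edge_ends setT.
Proof.
apply/matrixP => e f; rewrite mxE [RHS]mxE !inE /=.
have -> : #|edge_ends e :&: edge_ends f|%:R =
    \sum_(z : G) ((z \in edge_ends e) && (z \in edge_ends f))%:R :> R.
  rewrite -sum1_card natr_sum big_mkcond; apply: eq_bigr => z _.
  by rewrite inE; case: (_ && _).
rewrite [RHS](reindex _ (onW_bij _ (enum_val_bij G))) /=.
by apply: eq_bigr => i _; rewrite !mxE -natrM mulnb.
Qed.

(** Edges at x correspond to neighbours of x. *)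
Lemma card_edges_at x : #|[set E in edges G | x \in E]| = degree x.
Proof.
have inj : injective (fun y : G => [set x; y]).
  move=> y z /= E; have /set2P[yx|//] : y \in [set x; z] by rewrite -E set22.
  have /set2P[zx|//] : z \in [set x; y] by rewrite E set22.
  by rewrite yx zx.
rewrite /degree -(card_imset _ inj); apply: eq_card => E; rewrite inE.
apply/andP/imsetP => [[EG xE]|[y xy ->]]; last by rewrite edgesE set21; rewrite inE in xy.
have [a [b [Eab ab]]] := edges_pair EG; move: xE; rewrite Eab => /set2P[->|->].
  by exists b; rewrite ?inE.
by exists a; rewrite ?inE 1?adj_sym // setUC.
Qed.

Lemma laplacian_incidence : incidence *m incidence^T = signless_laplacian R G.
Proof.
apply/matrixP => i j; rewrite !mxE; set x := enum_val i; set y := enum_val j.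
have -> : \sum_e incidence i e * incidence^T e j =
    #|[set E in edges G | (x \in E) && (y \in E)]|%:R.
  rewrite -[in RHS]sum1_card natr_sum.
  rewrite (eq_bigl (fun E => (E \in edges G) && ((x \in E) && (y \in E)))); last first.
    by move=> E; rewrite inE.
  rewrite big_mkcondr [RHS]big_enum_val; apply: eq_bigr => e _.
  by rewrite !mxE -natrM mulnb; case: (_ && _).
have [ij|ij] := eqVneq i j.
  rewrite /x /y -ij adj_irr addr0 mulr1n -card_edges_at; congr (_%:R).
  by apply: eq_card => E; rewrite !inE andbb.
have xy : x != y by apply: contra_neq ij; exact: enum_val_inj.
rewrite add0r -edgesE; have [xyG|xyG] := boolP ([set x; y] \in edges G).
  rewrite (_ : [set E in _ | _] = [set [set x; y]]) ?cards1 //.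
  apply/setP => E; rewrite !inE; apply/and3P/eqP => [[EG xE yE]|->].
    have [a [b [Eab ab]]] := edges_pair EG; apply/esym/eqP.
    rewrite eqEcard subUset !sub1set xE yE /= Eab !cards2 xy.
    by case: (a != b).
  by rewrite xyG set21 set22.
rewrite (_ : [set E in _ | _] = set0) ?cards0 //.
apply/setP => E; rewrite !inE; apply/negbTE; apply: contra xyG => /and3P[EG xE yE].
suff -> : [set x; y] = E by [].
have [a [b [Eab ab]]] := edges_pair EG; apply/eqP.
rewrite eqEcard subUset !sub1set xE yE /= Eab !cards2 xy.
by case: (a != b).
Qed.

(** With a single component all vertices have the same root. *)
Lemma connect_adj x y : connected_graph G -> connect (@adj G) x y.
Proof.
rewrite /connected_graph /n_comp_mem => /eqP /fintype.card1P[r rP].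
have rootE z : fingraph.root (@adj G) z = r.
  apply/eqP; have := rP (fingraph.root (@adj G) z); rewrite !inE /= => <-.
  by rewrite andbT; apply: fingraph.roots_root; exact/sym_connect_sym/adj_sym.
apply/fingraph.rootP; last by rewrite !rootE.
exact/sym_connect_sym/adj_sym.
Qed.

(** The edges along a walk from an end of e to an end of f form a chain. *)
Lemma edge_ends_connected : connected_graph G -> line_connected edge_ends setT.
Proof.
move=> connG e f _ _.
have end_of g : exists z, z \in edge_ends g.
  by apply/set0Pn; rewrite -card_gt0 card_edge_ends.
have [x xe] := end_of e; have [y yf] := end_of f.
have /connectP[p xp yp] := connect_adj x y connG.
elim: p x e xe xp yp => [|z p IHp] x e xe /=.
  by move=> _ yx; apply: connect1; rewrite /line_rel !inE; apply/meetP; exists x => //; rewrite -yx.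
case/andP=> xz zp yp; have [g gE] := adj_edge xz.
apply: connect_trans (IHp z g _ zp yp); last by rewrite gE set22.
by apply: connect1; rewrite /line_rel !inE; apply/meetP; exists x => //; rewrite gE set21.
Qed.

End Incidence.

Theorem theorem3p17 (R : realType) (G : sgraph) (m : nat)
  (G_connected : connected_graph G) (m_edges : #|edges G| = m)
  (m_ge1 : (1 <= m)%N) (t : R) (t_ge2 : 2 <= t) :
  Psi t (path_graph m.+1) <= Psi t G.
Proof.
rewrite Psi_path //; have PsiE : Psi t G = psi t (signless_laplacian R G) by [].
have [t4|t4] := lerP t 4; last first.
  rewrite path_sum_ge2; last by lra.
  by rewrite /Psi sumr_ge0 // => x _; exact: sqr_ge0.
rewrite PsiE -laplacian_incidence; apply: le_trans (psi_gram_le _ _); last by lra.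
rewrite gram_incidence -m_edges.
have := @line_psi_ge R _ _ _ (@card_edge_ends G) (@edge_ends_inj G) t setT t_ge2 t4
  (edge_ends_connected G_connected).
rewrite cardsT card_ord; apply.
by rewrite -card_gt0 cardsT card_ord m_edges.
Qed.
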